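(* Let $f,g,k_x,k_y$ satisfy the plant assumption, let $\Phi=\Phi_u+\Phi_y$ and $\mathcal U$ satisfy the cost assumption, let the plant be monotone with respect to the standard orders ($\mathcal K_U=\mathbb R^m_{\ge0}$, $\mathcal K_X=\mathbb R^n_{\ge0}$, $\mathcal K_Y=\mathbb R^p_{\ge0}$), and let $\alpha>0$ (all as described in the context). Assume that either of the following holds: (i) the function $\Psi(v,x):=\Phi_u(v)+k_y(v)^\top\nabla\Phi_y(g(x))$ is strictly convex in $v$, for any fixed $x\in\mathbb R^n$; (ii) the function $\Phi_u$ is strictly convex, and the steady-state output map $k_y$ is affine. Then the system with input $x$ and state $v\in\mathcal U$, $$\dot v=\Pi_{\mathcal U}\bigl(v,-\alpha\nabla\Phi_u(v)-\alpha\nabla k_y(v)^\top\nabla\Phi_y(g(x))\bigr),$$ admits a well-defined steady-state map $k_v:\mathbb R^n\to\mathbb R^m$, i.e. for every constant $x\in\mathbb R^n$ and every initial condition in $\mathcal U$ the solution converges to $k_v(x)$ as $t\to\infty$; furthermore, $k_v$ is continuous.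
   Context: **Notation.** For differentiable $h:\mathbb R^a\to\mathbb R^b$, $\nabla h(x)\in\mathbb R^{b\times a}$ is the Jacobian; for scalar $h$, $\nabla h(x)$ also denotes the gradient (column vector). For a closed convex set $S\subseteq\mathbb R^n$, $\mathrm T_S(x)=\operatorname{cl}\bigl(\bigcup_{\delta>0}\frac1\delta(S-x)\bigr)$ is the tangent cone at $x\in S$, and $\Pi_S(x,v)$ is the Euclidean projection of $v$ onto $\mathrm T_S(x)$. All solutions of differential equations are in the Carathéodory sense (absolutely continuous, satisfying the equation for almost all $t$). **Orders.** An orthant $\mathcal K\subset\mathbb R^n$ induces the partial order $x\succcurlyeq_{\mathcal K}y\iff x-y\in\mathcal K$; $\mathbb R^n_{\ge0}$ gives the standard (elementwise) order. **Monotone system.** A system $\dot x=f(x,u)$, $y=g(x)$ is monotone with respect to orthants $\mathcal K_U,\mathcal K_X,\mathcal K_Y$ (in input, state and output space) if (1) for any two measurable, locally bounded inputs with $u(t)\succcurlyeq_{\mathcal K_U}u'(t)$ for almost all $t$ and any initial conditions $x_0\succcurlyeq_{\mathcal K_X}x_0'$, the corresponding solutions (assumed well defined) satisfy $x(t,x_0,u)\succcurlyeq_{\mathcal K_X}x(t,x_0',u')$ for all $t\ge 0$; and (2) $x\succcurlyeq_{\mathcal K_X}x'$ implies $g(x)\succcurlyeq_{\mathcal K_Y}g(x')$. **Plant assumption.** The plant is $\dot x=f(x,u)$, $y=g(x)$ with $f:\mathbb R^n\times\mathbb R^m\to\mathbb R^n$ and $g:\mathbb R^n\to\mathbb R^p$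 locally Lipschitz. There is a continuous steady-state map $k_x:\mathbb R^m\to\mathbb R^n$: for every constant input $\bar u\in\mathbb R^m$ and every initial condition, the solution of the plant converges to $k_x(\bar u)$ as $t\to\infty$. The steady-state output map is $k_y:=g\circ k_x:\mathbb R^m\to\mathbb R^p$; it is continuously differentiable and $\nabla k_y:\mathbb R^m\to\mathbb R^{p\times m}$ is locally Lipschitz. **Cost assumption.** $\Phi(u,y)=\Phi_u(u)+\Phi_y(y)$ with $\Phi:\mathbb R^m\times\mathbb R^p\to\mathbb R$ continuously differentiable and $\nabla\Phi$ locally Lipschitz. The set $\mathcal U=[u_1^{\min},u_1^{\max}]\times\dots\times[u_m^{\min},u_m^{\max}]\subset\mathbb R^m$ is a compact box. *)

(* Defs.v *)
From HB Require Import structures.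
From mathcomp Require Import all_boot all_order all_algebra.
From mathcomp Require Import all_classical all_reals all_analysis.

Set Implicit Arguments.
Unset Strict Implicit.
Unset Printing Implicit Defensive.

Import Order.TTheory GRing.Theory Num.Theory.
Import numFieldNormedType.Exports.

Local Open Scope classical_set_scope.
Local Open Scope ring_scope.

(* Vectors of R^a are row vectors 'rV[R]_a.  The library norm `|x| on them is
   the sup norm; it is used only where the choice of norm is irrelevant
   (continuity, Lipschitz continuity, absolute continuity, boundedness). *)

Section Vectors.
Context {R : realType}.

Definition dotv a (x y : 'rV[R]_a) : R := \sum_i x ord0 i * y ord0 i.

Definition enorm a (x : 'rV[R]_a) : R := Num.sqrt (dotv x x).

(* The b x a Jacobian matrix, with entry (i, j) the derivative of h_i along
   x_j; the library's 'J, made to act on row vectors, is its transpose. *)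
Definition jac a b (h : 'rV[R]_a -> 'rV[R]_b) (x : 'rV[R]_a) : 'M[R]_(b, a) :=
  ('J h x)^T.

Definition grad a (h : 'rV[R]_a -> R) (x : 'rV[R]_a) : 'rV[R]_a :=
  \row_i 'D_(delta_mx ord0 i) h x.

Definition strictly_convex a (h : 'rV[R]_a -> R) : Prop :=
  forall (x y : 'rV[R]_a) (t : R), x <> y -> 0 < t -> t < 1 ->
    h (t *: x + (1 - t) *: y) < t * h x + (1 - t) * h y.

Definition affine a b (h : 'rV[R]_a -> 'rV[R]_b) : Prop :=
  exists (A : 'M[R]_(a, b)) (c : 'rV[R]_b), forall x, h x = x *m A + c.

Definition box a (lo hi : 'rV[R]_a) : set 'rV[R]_a :=
  [set x | forall i, lo ord0 i <= x ord0 i <= hi ord0 i].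

Definition tangent_cone a (S : set 'rV[R]_a) (x : 'rV[R]_a) : set 'rV[R]_a :=
  closure (\bigcup_(d in [set d : R | 0 < d]) [set d^-1 *: (s - x) | s in S]).

(* [get] returns an arbitrary vector when no projection exists; it is unique
   and exists when S is closed and convex and x is in S. *)
Definition proj_tangent a (S : set 'rV[R]_a) (x v : 'rV[R]_a) : 'rV[R]_a :=
  get [set w | tangent_cone S x w /\
    forall z, tangent_cone S x z -> enorm (v - w) <= enorm (v - z)].

Definition nonneg_orthant (a : nat) : set 'rV[R]_a :=
  [set x | forall i, 0 <= x ord0 i].

Definition cone_ge a (K : set 'rV[R]_a) (x y : 'rV[R]_a) : Prop := K (x - y).

End Vectors.

Arguments nonneg_orthant {R} a _.

Section Solutions.
Context {R : realType}.

Definition abs_continuous a (lo hi : R) (x : R -> 'rV[R]_a) : Prop :=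
  forall e : R, 0 < e -> exists2 d : R, 0 < d &
    forall (N : nat) (s t : 'I_N -> R),
      (forall k, [/\ lo <= s k, s k <= t k & t k <= hi]) ->
      trivIset setT (fun k => `]s k, t k[%classic) ->
      \sum_k (t k - s k) < d -> \sum_k `|x (t k) - x (s k)| < e.

(* Caratheodory solutions on [0, +oo[ of x' = F(t, x), x(0) = x0, with states
   in D; the values of x at negative times are irrelevant. *)
Definition solution a (F : R -> 'rV[R]_a -> 'rV[R]_a) (D : set 'rV[R]_a)
    (x0 : 'rV[R]_a) (x : R -> 'rV[R]_a) : Prop :=
  [/\ x 0 = x0,
      forall t, 0 <= t -> D (x t),
      forall T, 0 <= T -> abs_continuous 0 T x &
      {ae lebesgue_measure, forall t : R,
         0 <= t -> is_derive t 1 x (F t (x t))}].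

Definition unique_solution a (F : R -> 'rV[R]_a -> 'rV[R]_a)
    (D : set 'rV[R]_a) (x0 : 'rV[R]_a) : Prop :=
  (exists x, solution F D x0 x) /\
  (forall x x', solution F D x0 x -> solution F D x0 x' ->
     forall t, 0 <= t -> x t = x' t).

(* k is the steady-state map of z' = F(z, w), with states z in D and
   input w. *)
Definition steady_state_map a b (F : 'rV[R]_a -> 'rV[R]_b -> 'rV[R]_a)
    (D : set 'rV[R]_a) (k : 'rV[R]_b -> 'rV[R]_a) : Prop :=
  forall (w : 'rV[R]_b) (z0 : 'rV[R]_a), D z0 ->
    unique_solution (fun _ z => F z w) D z0 /\
    (forall z, solution (fun _ z => F z w) D z0 z -> z t @[t --> +oo] --> k w).

Definition admissible_input a (u : R -> 'rV[R]_a) : Prop :=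
  (forall i, measurable_fun (`[0, +oo[%classic : set R)
               (fun t => u t ord0 i)) /\
  (forall T : R, exists M : R, forall t, 0 <= t <= T -> `|u t| <= M).

(* The first clause is the well-definedness of the solutions compared in the
   second one. *)
Definition monotone_system n m p (f : 'rV[R]_n -> 'rV[R]_m -> 'rV[R]_n)
    (g : 'rV[R]_n -> 'rV[R]_p)
    (KU : set 'rV[R]_m) (KX : set 'rV[R]_n) (KY : set 'rV[R]_p) : Prop :=
  [/\ forall u x0, admissible_input u ->
        unique_solution (fun t z => f z (u t)) setT x0,
      forall u u' x0 x0' x x',
        admissible_input u -> admissible_input u' ->
        {ae lebesgue_measure, forall t : R, 0 <= t -> cone_ge KU (u t) (u' t)} ->
        cone_ge KX x0 x0' ->
        solution (fun t z => f z (u t)) setT x0 x ->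
        solution (fun t z => f z (u' t)) setT x0' x' ->
        forall t, 0 <= t -> cone_ge KX (x t) (x' t) &
      forall x x', cone_ge KX x x' -> cone_ge KY (g x) (g x')].

End Solutions.

(* The library's [locally [lipschitz _ | _ in setT]] asks for a Lipschitz bound
   near every pair of points; near a pair of distinct points this amounts to
   local boundedness, so it is the usual local Lipschitz continuity. *)
Record plant_assumption (R : realType) (n m p : nat)
    (f : 'rV[R]_n -> 'rV[R]_m -> 'rV[R]_n) (g : 'rV[R]_n -> 'rV[R]_p)
    (kx : 'rV[R]_m -> 'rV[R]_n) : Prop := PlantAssumption {
  plant_f_lip : [locally [lipschitz f z.1 z.2 | z in setT]];
  plant_g_lip : [locally [lipschitz g z | z in setT]];
  plant_kx_continuous : continuous kx;
  plant_kx_steady : steady_state_map f setT kx;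
  plant_ky_diff : forall v, differentiable (g \o kx) v;
  plant_ky_C1 : continuous (jac (g \o kx));
  plant_jac_ky_lip : [locally [lipschitz jac (g \o kx) v | v in setT]]
}.

(* R^m x R^p is identified with R^(m + p) to form the gradient of Phi. *)
Record cost_assumption (R : realType) (m p : nat)
    (Phi : 'rV[R]_m -> 'rV[R]_p -> R)
    (Phi_u : 'rV[R]_m -> R) (Phi_y : 'rV[R]_p -> R)
    (umin umax : 'rV[R]_m)
    (Phi' := fun z : 'rV[R]_(m + p) => Phi (lsubmx z) (rsubmx z)) : Prop :=
  CostAssumption {
  cost_split : forall u y, Phi u y = Phi_u u + Phi_y y;
  cost_diff : forall z, differentiable Phi' z;
  cost_C1 : continuous (grad Phi');
  cost_grad_lip : [locally [lipschitz grad Phi' z | z in setT]];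
  cost_box : forall i, umin ord0 i <= umax ord0 i
}.

(* Main.v *)
Require Import Defs.
From HB Require Import structures.
From mathcomp Require Import all_boot all_order all_algebra.
From mathcomp Require Import all_classical all_reals all_analysis.
From mathcomp Require Import measurable_realfun.
From mathcomp Require Import ring lra.

Import Order.TTheory GRing.Theory Num.Theory.
Import numFieldNormedType.Exports.

Local Open Scope classical_set_scope.
Local Open Scope ring_scope.

Set Implicit Arguments.
Unset Strict Implicit.

(** For fixed x put psi v = Phi_u v + dotv (ky v) (grad Phi_y (g x)).  The
    system is the projected gradient flow of alpha * psi on the box U, and either
    assumption makes psi strictly convex: under (ii) it differs from Phi_u by an
    affine function.  Hence psi has a unique minimizer kv x on U, and three
    facts have to be established.

    Convergence and uniqueness (box_flow_converges, box_flow_unique).  The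
    projected velocity differs from the free one by a vector that makes a
    nonpositive product with v - z for every z in U (box_drift_obtuse).  With
    the gradient inequality convex_grad_le, the squared Euclidean distance to
    kv x has derivative at most - 2 alpha (psi v - psi (kv x)), which on the
    compact box is bounded away from 0 outside any neighbourhood of kv x
    (positive_gap); and the distance of two solutions is nonincreasing because
    the gradient is monotone.  Solutions being only absolutely continuous, these
    arguments rest on ac_nonincreasing.

    Continuity of kv (argmin_continuous).  When x varies a little, psi changes
    uniformly little on U, so by positive_gap its minimizer stays close.

    Existence (box_flow_exists).  The curve is a limit of Euler polygons whose
    steps follow the velocity and are then clamped to the box.  A box is
    special: for a constant velocity, clamping after each of many short steps or
    once after a long one gives the same point (clampD).  So k steps of length h
    and one step of length k h differ by O((k h)^2) even at the boundary
    (iter_euler_step), the dyadic polygons converge, and the limit v is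
    Lipschitz with v (t + s) within O(s^2) of one clamped step from v t
    (euler_limit).  Thus v has everywhere the projected velocity as right
    derivative; a Lipschitz function whose right difference quotients converge
    is the integral of their limit, hence is differentiable almost everywhere
    with that derivative (lipschitz_ae_is_derive). *)

(** * Sup norm and dot product of row vectors *)

Section RowVectors.
Context {R : realType}.

Lemma coord_norm_le m (x : 'rV[R]_m) i : `|x ord0 i| <= `|x|.
Proof.
rewrite [leRHS]/Num.Def.normr/= mx_normrE.
exact: (le_bigmax 0 (fun ij => `|x ij.1 ij.2|) (ord0, i)).
Qed.

Lemma row_norm_le m (x : 'rV[R]_m) c : 0 <= c ->
  (forall i, `|x ord0 i| <= c) -> `|x| <= c.
Proof.
move=> c0 xc; rewrite [leLHS]/Num.Def.normr/= mx_normrE bigmax_le// => -[j i] _.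
by rewrite ord1.
Qed.

Section DotProduct.
Variable m : nat.
Implicit Types u v w : 'rV[R]_m.

Lemma dotvC u v : dotv u v = dotv v u.
Proof. by apply: eq_bigr => i _; rewrite mulrC. Qed.

Lemma dotvDl u v w : dotv (u + v) w = dotv u w + dotv v w.
Proof. by rewrite -big_split; apply: eq_bigr => i _; rewrite mxE mulrDl. Qed.

Lemma dotvZl (c : R) u v : dotv (c *: u) v = c * dotv u v.
Proof. by rewrite /dotv mulr_sumr; apply: eq_bigr => i _; rewrite mxE mulrA. Qed.

Lemma dotvNl u v : dotv (- u) v = - dotv u v.
Proof. by rewrite -scaleN1r dotvZl mulN1r. Qed.

Lemma dotvBl u v w : dotv (u - v) w = dotv u w - dotv v w.
Proof. by rewrite dotvDl dotvNl. Qed.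

Lemma dotvBr u v w : dotv w (u - v) = dotv w u - dotv w v.
Proof. by rewrite dotvC dotvBl !(dotvC _ w). Qed.

Lemma dotv0l u : dotv 0 u = 0.
Proof. by rewrite /dotv big1// => i _; rewrite mxE mul0r. Qed.

Lemma dotv_ge0 u : 0 <= dotv u u.
Proof. by apply: sumr_ge0 => i _; rewrite -expr2 sqr_ge0. Qed.

Lemma sqr_coord_le_dotv u i : u ord0 i ^+ 2 <= dotv u u.
Proof.
rewrite /dotv (bigD1 i)//= -expr2 lerDl.
by apply: sumr_ge0 => j _; rewrite -expr2 sqr_ge0.
Qed.

Lemma norm_le_dotv u (e : R) : 0 <= e -> dotv u u <= e ^+ 2 -> `|u| <= e.
Proof.
move=> e0 ue; apply: row_norm_le => // i.
rewrite -(@ler_pXn2r _ 2) ?nnegrE// real_normK ?num_real//.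
exact: le_trans (sqr_coord_le_dotv u i) ue.
Qed.

Lemma dotv_norm_le u v : `|dotv u v| <= m%:R * (`|u| * `|v|).
Proof.
rewrite (le_trans (ler_norm_sum _ _ _))//.
rewrite -[X in X%:R * _]card_ord -sumr_const mulr_suml ler_sum// => i _.
by rewrite mul1r normrM ler_pM// coord_norm_le.
Qed.

End DotProduct.

End RowVectors.

(** * Clamping to an interval *)

Section Clamp.
Context {R : realType}.
Implicit Types (lo hi x y d z : R).

Definition clamp lo hi x : R := Num.max lo (Num.min hi x).

(** The projection of d onto the tangent cone of [lo, hi] at x.  Imposing both
    sign constraints in turn also gives the right value 0 when lo = hi. *)
Definition itv_drift lo hi x d : R :=
  let d1 := if x <= lo then Num.max d 0 else d in
  if hi <= x then Num.min d1 0 else d1.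

Lemma clamp_itv lo hi x : lo <= hi -> lo <= clamp lo hi x <= hi.
Proof. by move=> lh; rewrite /clamp le_max lexx/= ge_max lh ge_min lexx. Qed.

Lemma clamp_id lo hi x : lo <= x <= hi -> clamp lo hi x = x.
Proof. by move=> /andP[lx xh]; rewrite /clamp min_r// max_r. Qed.

Lemma clamp_hi lo hi x : lo <= hi -> hi <= x -> clamp lo hi x = hi.
Proof. by move=> lh hx; rewrite /clamp min_l// max_r. Qed.

Lemma clamp_lo lo hi x : x <= lo -> clamp lo hi x = lo.
Proof. by move=> xl; rewrite /clamp max_l// ge_min xl orbT. Qed.

Lemma clamp_lip lo hi x y : `|clamp lo hi x - clamp lo hi y| <= `|x - y|.
Proof.
have max_lip (a u v : R) : `|Num.max a u - Num.max a v| <= `|u - v|.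
  have := ler_norm (u - v); have := ler_norm (v - u); rewrite (distrC v u).
  by have [] := leP a u; have [] := leP a v; rewrite ler_norml; lra.
have min_lip (a u v : R) : `|Num.min a u - Num.min a v| <= `|u - v|.
  have := ler_norm (u - v); have := ler_norm (v - u); rewrite (distrC v u).
  by have [] := leP a u; have [] := leP a v; rewrite ler_norml; lra.
exact: le_trans (max_lip _ _ _) (min_lip _ _ _).
Qed.

(** A constant drift keeps its sign, so a point pushed against an endpoint stays
    there.  This exact semigroup property keeps the error of Euler steps
    quadratic at the boundary. *)
Lemma clampD lo hi x d s h : lo <= x <= hi -> 0 <= s -> 0 <= h ->
  clamp lo hi (clamp lo hi (x + s * d) + h * d) = clamp lo hi (x + (s + h) * d).
Proof.
move=> xlh s0 h0; rewrite mulrDl addrA.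
have [d0|d0] := leP 0 d.
  have sd := mulr_ge0 s0 d0; have hd := mulr_ge0 h0 d0.
  have [xh|hx] := leP (x + s * d) hi;
    first by rewrite (@clamp_id _ _ (x + s * d)); lra.
  by rewrite (@clamp_hi _ _ (x + s * d)) ?clamp_hi; lra.
have sd := mulr_ge0_le0 s0 (ltW d0); have hd := mulr_ge0_le0 h0 (ltW d0).
have [lx|xl] := leP lo (x + s * d);
  first by rewrite (@clamp_id _ _ (x + s * d)); lra.
by rewrite (@clamp_lo _ _ (x + s * d)) ?clamp_lo; lra.
Qed.

(** For small s the step feels only the endpoints active at x. *)
Lemma clamp_itv_drift lo hi x d : lo <= x <= hi ->
  \forall s \near 0^'+, clamp lo hi (x + s * d) - x = s * itv_drift lo hi x d.
Proof.
move=> /andP[lx xh].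
have small e : 0 < e -> \forall s \near 0^'+, s * `|d| < e.
  move=> e0; have d1 : 0 < `|d| + 1 by rewrite ltr_wpDl.
  near=> s; rewrite (@le_lt_trans _ _ (s * (`|d| + 1)))//.
    by rewrite ler_wpM2l ?lerDl.
  rewrite -ltr_pdivlMr//; near: s; apply: nbhs_right_lt; exact: divr_gt0.
have small' y z : \forall s \near 0^'+, y < z -> s * `|d| < z - y.
  have [yz|zy] := ltP y z; last by apply: nearW.
  by near do move=> _; apply: small; rewrite subr_gt0.
near=> s.
have s0 : 0 < s by [].
have h1 : lo < x -> s * `|d| < x - lo by near: s; exact: small'.
have h2 : x < hi -> s * `|d| < hi - x by near: s; exact: small'.
rewrite /itv_drift.
have [d0|d0] := leP 0 d.
  have sd0 := mulr_ge0 (ltW s0) d0; rewrite ger0_norm// in h1 h2.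
  rewrite if_same (min_r d0).
  have [x_hi|hi_x] := leP hi x; first by rewrite clamp_hi; lra.
  by rewrite clamp_id; have := h2 hi_x; lra.
have sd0 := mulr_ge0_le0 (ltW s0) (ltW d0); rewrite ltr0_norm// mulrN in h1 h2.
have [x_lo|lo_x] := leP x lo.
  by rewrite minxx if_same clamp_lo; lra.
by rewrite (min_l (ltW d0)) if_same clamp_id; have := h1 lo_x; lra.
Unshelve. all: by end_near. Qed.

(** The correction vanishes unless an endpoint is active, and then it points
    into the interval: it is an inward normal at x. *)
Lemma itv_drift_obtuse lo hi x d z : lo <= z <= hi ->
  (itv_drift lo hi x d - d) * (x - z) <= 0.
Proof.
move=> /andP[lz zh]; rewrite /itv_drift.
have [x_hi|hi_x] := leP hi x; have [x_lo|lo_x] := leP x lo.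
- have -> : x - z = 0 by lra.
  by rewrite mulr0.
- by apply: mulr_le0_ge0; [rewrite subr_le0 ge_min lexx|lra].
- by apply: mulr_ge0_le0; [rewrite subr_ge0 le_max lexx|lra].
- by rewrite subrr mul0r.
Qed.

End Clamp.

(** * Euler polygons in a box *)

Section GeometricSequences.
Context {R : realType}.

Lemma geometric_gap_le (a b c : R) :
  (forall n, a <= b + c * 2^-1 ^+ n) -> a <= b.
Proof.
move=> h; rewrite -subr_le0; apply: (@cvgr_to_ge _ \oo _ _ (geometric c 2^-1)).
  by apply: cvg_geometric; rewrite ger0_norm// invf_lt1// ltr1n.
by apply: nearW => n; rewrite lerBlDl; exact: h.
Qed.

(** The sequences u n - 2 c / 2^n and u n + 2 c / 2^n are nondecreasing and
    nonincreasing, so every number between them is the limit. *)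
Lemma geometric_cauchy (u : nat -> R) (c : R) :
  (forall n, `|u n.+1 - u n| <= c * 2^-1 ^+ n) ->
  exists l, forall n, `|u n - l| <= 2 * c * 2^-1 ^+ n.
Proof.
move=> uc.
pose lower n := u n - 2 * c * 2^-1 ^+ n; pose upper n := u n + 2 * c * 2^-1 ^+ n.
have nd : {homo lower : n k / (n <= k)%N >-> n <= k}.
  apply/nondecreasing_seqP => n; rewrite /lower exprS.
  by have := uc n; rewrite ler_norml; lra.
have ni : {homo upper : n k / (n <= k)%N >-> n >= k}.
  apply/nonincreasing_seqP => n; rewrite /upper exprS.
  by have := uc n; rewrite ler_norml; lra.
have c0 : 0 <= c by have := le_trans (normr_ge0 _) (uc 0%N); rewrite expr0 mulr1.
have lu n k : lower n <= upper k.
  apply: (@le_trans _ _ (lower (maxn n k))); first by apply: nd; exact: leq_maxl.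
  apply: (@le_trans _ _ (upper (maxn n k))); last by apply: ni; exact: leq_maxr.
  have : 0 <= c * 2^-1 ^+ maxn n k by rewrite mulr_ge0// exprn_ge0.
  by rewrite /lower /upper; lra.
exists (sup (range lower)) => n.
have : lower n <= sup (range lower).
  by apply: sup_upper_bound; [split; [exists (lower 0%N), 0%N|
    exists (upper 0%N) => _ [k _ <-]]|exists n].
have : sup (range lower) <= upper n.
  by apply: ge_sup; [exists (lower 0%N), 0%N|move=> _ [k _ <-]].
by rewrite ler_norml /lower /upper; lra.
Qed.

Lemma geometric_cauchy_row m (u : nat -> 'rV[R]_m) (c : R) :
  (forall n, `|u n.+1 - u n| <= c * 2^-1 ^+ n) ->
  exists l, forall n, `|u n - l| <= 2 * c * 2^-1 ^+ n.
Proof.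
move=> uc.
have c0 : 0 <= c by have := le_trans (normr_ge0 _) (uc 0%N); rewrite expr0 mulr1.
have /choice[l lP] i : exists l, forall n, `|u n ord0 i - l| <= 2 * c * 2^-1 ^+ n.
  apply: geometric_cauchy => n; apply: le_trans (uc n).
  by have := coord_norm_le (u n.+1 - u n) i; rewrite !mxE.
exists (\row_i l i) => n; apply: row_norm_le => [|i].
  by rewrite !mulr_ge0// exprn_ge0.
by rewrite !mxE.
Qed.

End GeometricSequences.

Section Euler.
Context {R : realType} {m : nat}.
Variables (lo hi : 'rV[R]_m) (F : 'rV[R]_m -> 'rV[R]_m) (L M : R).
Hypothesis lohi : forall i, lo ord0 i <= hi ord0 i.
Hypothesis L0 : 0 <= L.
Hypothesis M0 : 0 <= M.
Hypothesis F_lip : forall u v, box lo hi u -> box lo hi v ->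
  `|F u - F v| <= L * `|u - v|.
Hypothesis F_bound : forall u, box lo hi u -> `|F u| <= M.

Definition euler_step (h : R) (v : 'rV[R]_m) : 'rV[R]_m :=
  \row_i clamp (lo ord0 i) (hi ord0 i) (v ord0 i + h * F v ord0 i).

Lemma euler_step_box h v : box lo hi (euler_step h v).
Proof. by move=> i; rewrite mxE clamp_itv. Qed.

Lemma iter_euler_step_box h v k : box lo hi v ->
  box lo hi (iter k (euler_step h) v).
Proof. by case: k => // k _; exact: euler_step_box. Qed.

Lemma euler_step0 v : box lo hi v -> euler_step 0 v = v.
Proof.
by move=> bv; apply/rowP => i; rewrite !mxE mul0r addr0 clamp_id.
Qed.

Lemma euler_step_time h s v : box lo hi v ->
  `|euler_step h v - euler_step s v| <= `|h - s| * M.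
Proof.
move=> bv; apply: row_norm_le => [|i]; first exact: mulr_ge0.
rewrite !mxE (le_trans (clamp_lip _ _ _ _))//.
rewrite opprD addrACA subrr add0r -mulrBl normrM ler_wpM2l//.
exact: le_trans (coord_norm_le _ _) (F_bound bv).
Qed.

Lemma euler_step_move h v : 0 <= h -> box lo hi v ->
  `|euler_step h v - v| <= h * M.
Proof.
move=> h0 bv; have := euler_step_time h 0 bv.
by rewrite euler_step0// subr0 ger0_norm.
Qed.

Lemma euler_step_lip h u v : 0 <= h -> box lo hi u -> box lo hi v ->
  `|euler_step h u - euler_step h v| <= (1 + h * L) * `|u - v|.
Proof.
move=> h0 bu bv; apply: row_norm_le => [|i].
  by rewrite mulr_ge0// addr_ge0// mulr_ge0.
rewrite !mxE (le_trans (clamp_lip _ _ _ _))//.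
rewrite opprD addrACA -mulrBr (le_trans (ler_normD _ _))// mulrDl mul1r.
apply: lerD; first by have := coord_norm_le (u - v) i; rewrite !mxE.
rewrite normrM ger0_norm// -mulrA ler_wpM2l//.
apply: le_trans (F_lip bu bv).
by have := coord_norm_le (F u - F v) i; rewrite !mxE.
Qed.

(** By clampD, extending the step from v by h is a clamped move from
    euler_step s v along F v, whereas the step from w moves along F w. *)
Lemma euler_step_add s h v w : 0 <= s -> 0 <= h -> box lo hi v -> box lo hi w ->
  `|euler_step h w - euler_step (s + h) v| <=
    `|w - euler_step s v| + h * L * `|w - v|.
Proof.
move=> s0 h0 bv bw; apply: row_norm_le => [|i].
  by rewrite addr_ge0// !mulr_ge0.
rewrite !mxE -clampD//; set c := clamp _ _ (v ord0 i + _).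
rewrite (le_trans (clamp_lip _ _ _ _))//.
rewrite opprD addrACA -mulrBr (le_trans (ler_normD _ _))//.
apply: lerD; first by have := coord_norm_le (w - euler_step s v) i; rewrite !mxE.
rewrite normrM ger0_norm// -mulrA ler_wpM2l//.
apply: le_trans (F_lip bw bv).
by have := coord_norm_le (F w - F v) i; rewrite !mxE.
Qed.

Lemma iter_euler_step_move h v k : 0 <= h -> box lo hi v ->
  `|iter k (euler_step h) v - v| <= k%:R * h * M.
Proof.
move=> h0 bv; elim: k => [|k IH]; first by rewrite subrr normr0 !mul0r.
rewrite iterS -(subrKA (iter k (euler_step h) v)) (le_trans (ler_normD _ _))//.
have := euler_step_move h0 (iter_euler_step_box h k bv).
by rewrite -natr1; lra.
Qed.

(** Each new step adds at most h L times the distance travelled so far, which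
    is itself at most k h M: the error is quadratic in the elapsed time k h. *)
Lemma iter_euler_step h v k : 0 <= h -> box lo hi v ->
  `|iter k (euler_step h) v - euler_step (k%:R * h) v| <=
    L * M * (k%:R * h) ^+ 2.
Proof.
move=> h0 bv; elim: k => [|k IH].
  by rewrite mul0r euler_step0//= subrr normr0 expr0n/= mulr0.
rewrite iterS -natr1 mulrDl mul1r.
have kh0 : 0 <= k%:R * h by rewrite mulr_ge0.
rewrite (le_trans (euler_step_add kh0 h0 bv (iter_euler_step_box h k bv)))//.
have := iter_euler_step_move k h0 bv; move: IH kh0; set w := `|_ - v|.
set x := k%:R * h.
move=> IH x0 wx.
have : h * L * w <= h * L * (x * M) by rewrite ler_wpM2l// mulr_ge0.
have : 0 <= L * M * (h * x + h ^+ 2).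
  by rewrite !mulr_ge0// addr_ge0 ?exprn_ge0// mulr_ge0.
by rewrite sqrrD mulrDr mulrDr; lra.
Qed.

(** One coarse step and two half steps from the same point differ by L M h^2
    (iter_euler_step with k = 2), and a coarse step stretches distances by at
    most 1 + h L. *)
Lemma iter_euler_step_half h v k : 0 <= h -> box lo hi v ->
  `|iter k.*2 (euler_step (h / 2)) v - iter k (euler_step h) v| <=
    k%:R * (L * M * h ^+ 2) * (1 + h * L) ^+ k.
Proof.
move=> h0 bv; elim: k => [|k IH]; first by rewrite subrr normr0 !mul0r.
have h20 : 0 <= h / 2 by rewrite divr_ge0.
have hL : 1 <= 1 + h * L by rewrite lerDl mulr_ge0.
rewrite doubleS (iterD 2 k.*2) [iter k.+1 _ _]iterS.
move: IH; set x := iter k.*2 _ _; set y := iter k _ _ => IH.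
have bx : box lo hi x by exact: iter_euler_step_box.
have by_ : box lo hi y by exact: iter_euler_step_box.
have local : `|iter 2 (euler_step (h / 2)) x - euler_step h x| <= L * M * h ^+ 2.
  by have := iter_euler_step 2 h20 bx; rewrite [2%:R * _]mulrC divfK.
have stable := euler_step_lip h0 bx by_.
rewrite -(subrKA (euler_step h x)) (le_trans (ler_normD _ _))//.
rewrite (le_trans (lerD local (le_trans stable (ler_wpM2l _ IH))))//.
  by rewrite (le_trans ler01).
rewrite addrC -natr1 (mulrDl k%:R) mul1r (mulrDl (k%:R * _)).
apply: lerD; first by rewrite (exprS _ k) [leLHS]mulrCA.
rewrite ler_peMr//; first by rewrite !mulr_ge0// exprn_ge0.
exact: exprn_ege1.
Qed.

Variable v0 : 'rV[R]_m.
Hypothesis bv0 : box lo hi v0.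

Let mesh N : R := 2^-1 ^+ N.

(** The polygon of mesh 2^-N, with time rounded down to the grid.  As truncn
    vanishes on negative numbers, it is constant before time 0. *)
Definition euler_path (N : nat) (t : R) : 'rV[R]_m :=
  iter (Num.truncn (t * 2 ^+ N)) (euler_step (2^-1 ^+ N)) v0.

Let mesh0 N : 0 < mesh N. Proof. by rewrite exprn_gt0. Qed.
Let meshK N : 2 ^+ N * mesh N = 1.
Proof. by rewrite -exprMn divff// expr1n. Qed.
Let mesh1 N : mesh N <= 1.
Proof. by apply: exprn_ile1 => //; rewrite invf_le1// ler1n. Qed.

Lemma euler_path_box N t : box lo hi (euler_path N t).
Proof. exact: iter_euler_step_box. Qed.

Lemma euler_path_le0 N t : t <= 0 -> euler_path N t = v0.
Proof.
move=> t0; rewrite /euler_path (_ : Num.truncn _ = 0%N)//.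
apply/eqP; rewrite -leqn0 truncn_le_nat.
by rewrite (@le_lt_trans _ _ 0)// mulr_le0_ge0// exprn_ge0.
Qed.

Let C t := t * (L * M) * expR (t * L) + M.

Lemma euler_path_cauchy N t : 0 <= t ->
  `|euler_path N.+1 t - euler_path N t| <= C t * 2^-1 ^+ N.
Proof.
move=> t0.
have p0 : 0 <= t * 2 ^+ N by rewrite mulr_ge0// exprn_ge0.
have := truncn_itv p0; rewrite /euler_path; set k := Num.truncn (t * 2 ^+ N).
move=> /andP[kt tk]; have kh : k%:R * mesh N <= t.
  by have := ler_wpM2r (ltW (mesh0 N)) kt; rewrite -mulrA meshK mulr1.
(* Refining the grid turns index k into 2 k or 2 k + 1; an index 2 k + 1 costs
   one more half step. *)
have [b ->] : exists b : bool, Num.truncn (t * 2 ^+ N.+1) = (b + k.*2)%N.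
  have p1 : 0 <= t * 2 ^+ N.+1 by rewrite mulr_ge0// exprn_ge0.
  have [tb|tb] := ltP (t * 2 ^+ N.+1) (k.*2.+1)%:R; [exists false|exists true].
    apply/eqP; rewrite truncn_eq// tb andbT exprS -muln2 natrM.
    by lra.
  apply/eqP; rewrite truncn_eq// tb/= exprS add1n -doubleS -muln2 natrM.
  by lra.
have mE : mesh N.+1 = mesh N / 2 by rewrite /mesh exprS mulrC.
rewrite iterD -/(mesh N) -/(mesh N.+1) mE.
set x := iter k.*2 _ v0.
have bx : box lo hi x by exact: iter_euler_step_box.
have h0 := mesh0 N; set h := mesh N in kh h0 *.
have last_step : `|iter b (euler_step (h / 2)) x - x| <= h * M.
  apply: le_trans (iter_euler_step_move b _ bx) _; first by lra.
  rewrite ler_wpM2r//; case: (b); rewrite ?mul1r ?mul0r; lra.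
have grid := iter_euler_step_half k (ltW h0) bv0.
rewrite -(subrKA x) (le_trans (ler_normD _ _))// addrC [C t]/C mulrDl [M * h]mulrC.
apply: lerD last_step; apply: le_trans grid _.
have -> : k%:R * (L * M * h ^+ 2) * (1 + h * L) ^+ k =
  k%:R * h * (L * M) * (1 + h * L) ^+ k * h by ring.
rewrite ler_wpM2r ?(ltW h0)// ler_pM//.
- by rewrite !mulr_ge0// ltW.
- by rewrite exprn_ge0// addr_ge0// mulr_ge0// ltW.
- by rewrite ler_wpM2r// mulr_ge0.
rewrite (@le_trans _ _ (expR (h * L) ^+ k))//.
  by rewrite lerXn2r ?nnegrE ?expR_ge0 ?expR_ge1Dx// addr_ge0// mulr_ge0// ltW.
by rewrite -expRM_natl ler_expR mulrA ler_wpM2r.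
Qed.

Lemma euler_path_limit : exists v : R -> 'rV[R]_m,
  (forall t, t <= 0 -> v t = v0) /\
  forall t, exists2 c, 0 <= c &
    forall N, `|euler_path N t - v t| <= c * 2^-1 ^+ N.
Proof.
have /choice[v vP] t : exists l, (t <= 0 -> l = v0) /\ exists2 c, 0 <= c &
    forall N, `|euler_path N t - l| <= c * 2^-1 ^+ N.
  have [t0|t0] := leP t 0.
    exists v0; split => //; exists 0 => // N.
    by rewrite euler_path_le0// subrr normr0 mul0r.
  have [l lP] := geometric_cauchy_row (fun N => euler_path_cauchy N (ltW t0)).
  exists l; split; first by [].
  exists (2 * C t) => //; rewrite mulr_ge0// addr_ge0// !mulr_ge0 ?expR_ge0//.
  exact: ltW.
by exists v; split=> t; have [] := vP t.
Qed.

Lemma truncn_gap N s t : s <= t -> 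
  (Num.truncn (t * 2 ^+ N))%:R * mesh N - (Num.truncn (s * 2 ^+ N))%:R * mesh N
    <= t - s + mesh N.
Proof.
move=> st.
have -> : t - s + mesh N = (t * 2 ^+ N - s * 2 ^+ N + 1) * mesh N.
  by rewrite mulrDl mulrBl -!mulrA meshK !mulr1 mul1r.
rewrite -mulrBl ler_wpM2r ?(ltW (mesh0 N))//.
have := truncnS_gt (s * 2 ^+ N); rewrite -natr1.
have [t0|t0] := leP 0 (t * 2 ^+ N).
  by have := truncn_itv t0; lra.
have : s * 2 ^+ N <= t * 2 ^+ N by rewrite ler_wpM2r// exprn_ge0.
have -> : Num.truncn (t * 2 ^+ N) = 0%N.
  by apply/eqP; rewrite -leqn0 truncn_le_nat (lt_trans t0).
have : 0 <= (Num.truncn (s * 2 ^+ N))%:R :> R by [].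
lra.
Qed.

(** The last bound contains the differential equation: euler_step s is the
    clamped move of length s along F, so it determines the right derivative. *)
Lemma euler_limit : exists v : R -> 'rV[R]_m,
  [/\ forall t, t <= 0 -> v t = v0,
      forall t, box lo hi (v t),
      forall s t, `|v t - v s| <= M * `|t - s| &
      forall t s, 0 <= t -> 0 <= s ->
        `|v (t + s) - euler_step s (v t)| <= L * M * s ^+ 2].
Proof.
have [v [v_le0 vP]] := euler_path_limit.
have v_box t : box lo hi (v t).
  move=> i; have [c c0 cP] := vP t.
  have vc N := le_trans (coord_norm_le (euler_path N t - v t) i) (cP N).
  have eb N := euler_path_box N t i.
  apply/andP; split; apply: (@geometric_gap_le _ _ _ c) => N.
    by have := vc N; have := eb N; rewrite !mxE ler_norml; lra.
  by have := vc N; have := eb N; rewrite !mxE ler_norml; lra.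
exists v; split => //.
- move=> s t; wlog st : s t / s <= t.
    move=> hw; have [st|ts] := leP s t; first exact: hw.
    by rewrite distrC [`|t - s|]distrC; apply: hw; exact: ltW.
  have [c c0 cP] := vP t; have [d d0 dP] := vP s.
  rewrite [`|t - s|]ger0_norm ?subr_ge0//.
  apply: (@geometric_gap_le _ _ _ (c + d + M)) => N.
  have gap := truncn_gap N st.
  have e_st : `|euler_path N t - euler_path N s| <= M * (t - s + mesh N).
    rewrite /euler_path.
    rewrite -(@subnK (Num.truncn (s * 2 ^+ N)) (Num.truncn (t * 2 ^+ N))).
      rewrite iterD (le_trans (iter_euler_step_move _ _ _))//.
        exact: iter_euler_step_box.
      rewrite mulrC ler_wpM2l// natrB ?mulrBl//.
      by apply: le_truncn; rewrite ler_wpM2r// exprn_ge0.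
    by apply: le_truncn; rewrite ler_wpM2r// exprn_ge0.
  have t1 := ler_distD (euler_path N t) (v t) (v s).
  have t2 := ler_distD (euler_path N s) (euler_path N t) (v s).
  have := cP N; have := dP N; rewrite (distrC (euler_path N t) (v t)).
  by rewrite -/(mesh N); lra.
- move=> t s t0 s0.
  have [c c0 cP] := vP (t + s); have [d d0 dP] := vP t.
  apply: (@geometric_gap_le _ _ _ (c + L * M * (2 * s + 1) + M + (1 + s * L) * d)).
  move=> N; have h0 := mesh0 N; have h1 := mesh1 N.
  have bt := v_box t.
  have gap : t <= t + s by lra.
  have := truncn_gap N gap.
  have tn0 : 0 <= t * 2 ^+ N by rewrite mulr_ge0// exprn_ge0.
  have kk : (Num.truncn (t * 2 ^+ N) <= Num.truncn ((t + s) * 2 ^+ N))%N.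
    by apply: le_truncn; rewrite ler_wpM2r ?exprn_ge0// lerDl.
  pose j := (Num.truncn ((t + s) * 2 ^+ N) - Num.truncn (t * 2 ^+ N))%N.
  rewrite -mulrBl -natrB// -/j => gap1.
  have gap2 : s - mesh N <= j%:R * mesh N.
    have -> : s - mesh N = ((t + s) * 2 ^+ N - t * 2 ^+ N - 1) * mesh N.
      by rewrite !mulrBl -!mulrA meshK !mulr1 mul1r; lra.
    rewrite ler_wpM2r ?(ltW h0)// natrB//.
    have := truncnS_gt ((t + s) * 2 ^+ N); rewrite -natr1.
    by have := truncn_itv tn0; lra.
  pose x := euler_path N t.
  have bx : box lo hi x by exact: euler_path_box.
  have eE : euler_path N (t + s) = iter j (euler_step (mesh N)) x.
    by rewrite /x /euler_path -iterD subnK.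
  have jh0 : 0 <= j%:R * mesh N by rewrite mulr_ge0// ltW.
  have e1 := iter_euler_step j (ltW h0) bx; rewrite -eE in e1.
  have e2 := euler_step_time (j%:R * mesh N) s bx.
  have e3 := euler_step_lip s0 bx bt.
  have e4 : (1 + s * L) * `|x - v t| <= (1 + s * L) * (d * mesh N).
    by apply: ler_wpM2l; [rewrite addr_ge0// mulr_ge0|exact: dP].
  have e5 : L * M * (j%:R * mesh N) ^+ 2 <= L * M * (s + mesh N) ^+ 2.
    by rewrite ler_wpM2l ?mulr_ge0// lerXn2r ?nnegrE; lra.
  have e6 : `|j%:R * mesh N - s| * M <= mesh N * M.
    by rewrite ler_wpM2r// ler_norml; lra.
  have e7 : L * M * (s + mesh N) ^+ 2 <=
      L * M * s ^+ 2 + L * M * (2 * s + 1) * mesh N.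
    have h2 : mesh N ^+ 2 <= mesh N by rewrite expr2 ler_piMl// ltW.
    by have := ler_wpM2l (mulr_ge0 L0 M0) h2; rewrite sqrrD; lra.
  have t1 := ler_distD (euler_path N (t + s)) (v (t + s)) (euler_step s (v t)).
  have t2 := ler_distD (euler_step (j%:R * mesh N) x) (euler_path N (t + s))
    (euler_step s (v t)).
  have t3 := ler_distD (euler_step s x) (euler_step (j%:R * mesh N) x)
    (euler_step s (v t)).
  have := cP N; have := dP N; rewrite (distrC (euler_path N (t + s)) (v (t + s))).
  by rewrite -/(mesh N) -/x; lra.
Qed.
End Euler.

(** * Almost everywhere differentiability from right difference quotients *)

(** If the right difference quotients q n of a Lipschitz function f converge
    everywhere to D, then f is a primitive of D: q n is the derivative of the
    mean of f over [t, t + 1/(n+1)], so its integral over [a, x] is a difference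
    of two such means, and dominated convergence applies.  Lebesgue's
    differentiation theorem then gives the derivative almost everywhere. *)
Section RightDerivative.
Context {R : realType}.
Notation mu := (@lebesgue_measure R).
Variables (f D : R -> R) (M : R).
Hypothesis f_lip : forall s t, `|f t - f s| <= M * `|t - s|.
Hypothesis f_right : forall t,
  n.+1%:R * (f (t + n.+1%:R^-1) - f t) @[n --> \oo] --> D t.

Let f_cont : continuous f.
Proof.
move=> t; apply/cvgrPdist_lt => e e0.
have M1 : 0 < `|M| + 1 by rewrite ltr_wpDl.
near=> s.
rewrite (le_lt_trans (f_lip _ _))// (@le_lt_trans _ _ ((`|M| + 1) * `|t - s|))//.
  by rewrite ler_wpM2r// (le_trans (ler_norm _))// lerDl.
rewrite mulrC -ltr_pdivlMr//.
by near: s; apply: cvgr_dist_lt => //; rewrite divr_gt0.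
Unshelve. all: by end_near. Qed.

Let q n t := n.+1%:R * (f (t + n.+1%:R^-1) - f t).

Let q_cont n : continuous (q n).
Proof.
move=> t; apply: cvgM; first exact: cvg_cst.
apply: cvgB; last exact: f_cont.
apply: (@cvg_comp _ _ _ (fun x => x + n.+1%:R^-1) f _ (nbhs (t + n.+1%:R^-1))).
  by apply: cvgD; [exact: cvg_id|exact: cvg_cst].
exact: f_cont.
Qed.

Let q_bound n t : `|q n t| <= M.
Proof.
rewrite normrM ger0_norm// -ler_pdivlMl//.
by rewrite (le_trans (f_lip _ _))// addrAC subrr add0r ger0_norm// mulrC.
Qed.

Let D_meas : measurable_fun setT D.
Proof.
apply/measurable_EFinP.
apply: (@emeasurable_fun_cvg _ _ _ _ (fun n t => (q n t)%:E)) => //.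
- move=> n; apply/measurable_EFinP; exact: continuous_measurable_fun.
- by move=> t _; apply: cvg_EFin; [exact: nearW|exact: f_right].
Qed.

Let D_bound t : `|D t| <= M.
Proof.
apply: (@cvgr_to_le _ _ _ _ (fun n => `|q n t|) _ _
  (cvg_norm (@f_right t))).
by apply: nearW => n; exact: q_bound.
Qed.

Let D_integrable (A : set R) : compact A -> mu.-integrable A (EFin \o D).
Proof.
move=> cA; apply: measurable_bounded_integrable.
- exact: compact_measurable.
- exact: compact_finite_measure.
- exact: measurable_funTS.
- exists M; split; first exact: num_real.
  by move=> K MK t At; rewrite /= (le_trans (D_bound t))// ltW.
Qed.

Let derive_seq (P : R -> R) (y l : R) : is_derive y 1 P l ->
  n.+1%:R * (P (y + n.+1%:R^-1) - P y) @[n --> \oo] --> l.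
Proof.
move=> [dP <-].
have h0 : (n.+1%:R^-1 : R) @[n --> \oo] --> 0^'.
  move=> A A0; have [N _ HN] := @cvg_harmonic R _ A0.
  by exists N => // n Nn; apply: (HN n Nn); rewrite invr_neq0// pnatr_eq0.
have := cvg_comp _ _ h0 dP; apply: cvg_trans; apply: near_eq_cvg.
by apply: nearW => n /=; rewrite invrK scaler1 [_^-1 + y]addrC.
Qed.

Let integral_D (a x : R) : a < x ->
  (\int[mu]_(t in `[a, x]) D t)%R = f x - f a.
Proof.
move=> ax.
have f_int u v : mu.-integrable `[u, v] (EFin \o f).
  by apply: continuous_compact_integrable;
    [exact: segment_compact|exact: continuous_subspaceT].
pose P y := (\int[mu]_(t in `[a - 1, y]) f t)%R.
have dP y : a - 1 < y -> is_derive y 1 P (f y).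
  move=> ay.
  have [] := @continuous_FTC1_closed _ f (a - 1) y (y + 1) _ (f_int _ _) ay _.
  - by rewrite ltrDl.
  - exact: f_cont.
  - by move=> d1 d2; apply: DeriveDef; [exact: d1|rewrite -d2 derive1E].
pose G n y := n.+1%:R * (P (y + n.+1%:R^-1) - P y).
have dG n y : a - 1 < y -> is_derive y 1 (G n) (q n y).
  move=> ay.
  have ay' : a - 1 < y + n.+1%:R^-1 by rewrite (lt_trans ay)// ltrDl.
  have := dP _ ay; have := dP _ ay' => d1 d2.
  have d3 : is_derive y 1 (fun z => P (z + n.+1%:R^-1)) (f (y + n.+1%:R^-1)).
    rewrite -[f (y + _)]mulr1.
    have dz : is_derive y 1 (fun z => z + n.+1%:R^-1 : R) 1.
      by rewrite -[1 in X in is_derive _ _ _ X]addr0; apply: is_deriveD.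
    exact: (@is_derive1_comp _ P).
  exact: (@is_deriveZ _ _ _ _ n.+1%:R _ _ _ (is_deriveB d3 d2)).
have intq n : (\int[mu]_(t in `[a, x]) (q n t)%:E = (G n x - G n a)%:E)%E.
  rewrite (@continuous_FTC2 _ (q n) (G n) a x)//.
  - by apply: continuous_subspaceT; exact: q_cont.
  - have dGc y : a - 1 < y -> {for y, continuous (G n)}.
      by move=> /(dG n) [d _]; apply/differentiable_continuous/derivable1_diffP.
    split.
    + move=> y; rewrite in_itv/= => /andP[ay _].
      by have [] := dG n y; first by lra.
    + by apply: cvg_at_right_filter; apply: dGc; lra.
    + by apply: cvg_at_left_filter; apply: dGc; lra.
  - move=> y; rewrite in_itv/= => /andP[ay _].
    by have [] := dG n y; [by lra|move=> _ <-; rewrite derive1E].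
have cvG : G n x - G n a @[n --> \oo] --> f x - f a.
  by apply: cvgB; apply: derive_seq; apply: dP; lra.
have [] := @dominated_convergence _ _ _ mu `[a, x] _ (fun n t => (q n t)%:E)
   (EFin \o D) (fun=> M%:E).
- exact: measurable_itv.
- move=> n; apply/measurable_EFinP; apply: measurable_funTS.
  exact: continuous_measurable_fun.
- by apply/measurable_EFinP; apply: measurable_funTS.
- apply: aeW => t _; apply: cvg_EFin; [exact: nearW|exact: f_right].
- apply: (@continuous_compact_integrable _ (fun=> M)).
    exact: segment_compact.
  by move=> z; exact: cvg_cst.
- by apply: aeW => t n _; rewrite /= lee_fin.
move=> _ _ cvI.
rewrite /Rintegral; apply: EFin_inj.
rewrite fineK; last first.
  apply: integrable_fin_num => //; apply: D_integrable; exact: segment_compact.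
have := cvg_unique _ cvI; apply => //.
rewrite (_ : (fun n => _) = (fun n => (G n x - G n a)%:E)).
  by apply: cvg_EFin; [exact: nearW|].
by apply/funext => n; rewrite intq.
Qed.

Lemma lipschitz_ae_is_derive (a : R) :
  {ae mu, forall t : R, a < t -> is_derive t 1 f (D t)}.
Proof.
have D_int u v : mu.-integrable `[u, v] (EFin \o D).
  by apply: D_integrable; exact: segment_compact.
have D_loc : locally_integrable setT D.
  split => //; first exact: openT.
  by move=> K _ /D_integrable /integrableP[].
have := FTC1 (fun y => D_int a y) D_loc.
apply: filterS; first exact: (ae_filter_ringOfSetsType mu).
move=> t /= dD at_; have [|dt tE] := dD; first exact: at_.
apply: (@near_eq_is_derive R R R
  (fun y => (\int[mu]_(s in `[a, y]) D s)%R + f a)).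
  by near=> y; rewrite integral_D ?subrK//; near: y; exact: lt_nbhsr.
rewrite -[D t]addr0; apply: is_deriveD.
by apply: DeriveDef; [exact: dt|rewrite -derive1E tE].
Unshelve. all: by end_near. Qed.
End RightDerivative.

(** * Absolutely continuous functions with nonpositive derivative *)

Section AbsolutelyContinuous.
Context {R : realType}.
Notation mu := (@lebesgue_measure R).

(** Induction along a segment: P passes from points just left of the supremum
    of its reach to points just right of it, so the reach is the whole segment. *)
Lemma segment_ind (P : R -> Prop) (a b : R) : a <= b -> P a ->
  (forall s, a <= s <= b -> exists2 r, 0 < r & forall u v,
     a <= u -> u <= s -> s <= v -> v <= b -> s - r < u -> v < s + r ->
     P u -> P v) ->
  P b.
Proof.
move=> ab Pa step.
pose E := [set c | a <= c <= b /\ P c].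
have Ea : E a by split; rewrite ?lexx.
have supE : has_sup E by split; [exists a|exists b => c [/andP[]]].
have as_ : a <= sup E by apply: sup_upper_bound.
have sb : sup E <= b by apply: ge_sup => [|c [/andP[]]//]; exists a.
have [r r0 Pr] := step _ (introT andP (conj as_ sb)).
have [c [/andP[ac cb] Pc] rc] := sup_adherent r0 supE.
have cs : c <= sup E by apply: sup_upper_bound => //; split => //; apply/andP.
have [br|rb] := leP b (sup E + r / 2).
  by apply: (Pr c b) => //; lra.
have : E (sup E + r / 2).
  by split; [lra|apply: (Pr c) => //; lra].
by move=> /(sup_upper_bound supE); lra.
Qed.

Lemma is_derive_le0_near (g : R -> R) (s l e : R) : 0 < e -> l <= 0 ->
  is_derive s 1 g l ->
  exists2 r, 0 < r & forall u v, u <= s -> s <= v -> s - r < u -> v < s + r ->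
     g v - g u <= e * (v - u).
Proof.
move=> e0 l0 [dg gl].
have /cvgrPdist_lt/(_ _ e0) : h^-1 *: (g (h *: 1 + s) - g s) @[h --> 0^'] --> l.
  by rewrite -gl; exact: dg.
move=> [r /= r0 gr]; exists r => // u v us sv ru vr.
have gs h : h != 0 -> `|h| < r -> h^-1 * (g (s + h) - g s) < e.
  move=> h0 hr; have := gr h; rewrite /= sub0r normrN => /(_ hr h0).
  rewrite [h *: _]mulr1 [h + s]addrC ltr_norml => /andP[+ _].
  by rewrite /GRing.scale /=; lra.
have gsv : g v - g s <= e * (v - s).
  have [->|vs] := eqVneq v s; first by rewrite !subrr mulr0.
  have vs0 : 0 < v - s by rewrite subr_gt0 lt_neqAle eq_sym vs.
  have := gs (v - s) (lt0r_neq0 vs0); rewrite gtr0_norm// subrKC.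
  by rewrite mulrC ltr_pdivrMr// => /(_ _)/ltW; apply; lra.
have gus : g s - g u <= e * (s - u).
  have [->|su] := eqVneq s u; first by rewrite !subrr mulr0.
  have su0 : 0 < s - u by rewrite subr_gt0 lt_neqAle eq_sym su.
  have := gs (u - s); rewrite -(opprB s u) normrN gtr0_norm// oppr_eq0.
  rewrite gt_eqF// subKr invrN mulNr -mulrN opprB mulrC ltr_pdivrMr//.
  by move=> /(_ _ _)/ltW; apply => //; lra.
lra.
Qed.

(** The scalar counterpart of abs_continuous. *)
Definition ac_fun (a b : R) (g : R -> R) : Prop :=
  forall e : R, 0 < e -> exists2 d : R, 0 < d &
    forall (N : nat) (s t : 'I_N -> R),
      (forall k, [/\ a <= s k, s k <= t k & t k <= b]) ->
      trivIset setT (fun k => `]s k, t k[%classic) ->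
      \sum_k (t k - s k) < d -> \sum_k `|g (t k) - g (s k)| < e.

Lemma sum_disjoint_itv_le (N : nat) (s t : 'I_N -> R) (V : set R) :
  measurable V -> (forall k, s k <= t k) ->
  (forall k, `]s k, t k[ `<=` V) ->
  trivIset setT (fun k => `]s k, t k[%classic) ->
  ((\sum_k (t k - s k))%:E <= mu V)%E.
Proof.
move=> mO st sO tI.
rewrite (@le_trans _ _ (mu (\bigcup_(k in [set: 'I_N]) `]s k, t k[%classic)))//.
  rewrite measure_fin_bigcup//; last exact: finite_finset.
  rewrite (_ : [set: 'I_N] = [set` index_enum 'I_N]); last first.
    by apply/seteqP; split => // k _ /=; rewrite mem_index_enum.
  rewrite -fsbig_seq ?index_enum_uniq// -sumEFin.
  rewrite le_eqVlt; apply/orP; left; apply/eqP/eq_bigr => k _.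
  transitivity (mu `]s k, t k[%classic); last by [].
  rewrite lebesgue_measure_itv.
  rewrite /= lte_fin; case: ltP => // ts.
  have -> : s k = t k by apply/eqP; rewrite eq_le st.
  by rewrite subrr.
apply: le_measure; rewrite ?inE//.
- by apply: open_measurable; apply: bigcup_open => k _; exact: interval_open.
- by apply: bigcup_sub => k _; exact: sO.
Qed.

(** Cover the exceptional null set by an open set V of small measure.  Walking
    from a to b, near a point outside the null set the increase of g is at most
    e times the length; near a point of it the step is recorded as an interval
    inside V.  The recorded intervals are disjoint with small total length, so by
    absolute continuity they contribute at most e. *)
Lemma ac_nonincreasing (a b : R) (g : R -> R) : a <= b -> ac_fun a b g ->
  {ae mu, forall t, a <= t <= b -> exists2 l, l <= 0 & is_derive t 1 g l} ->
  g b <= g a.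
Proof.
move=> ab acg [N [mN N0 sN]].
suff ge e : 0 < e -> g b - g a <= e * (b - a) + e.
  apply/ler_addgt0Pr => e e0.
  have ba1 : 0 < b - a + 1 by lra.
  have := ge (e / (b - a + 1)) (divr_gt0 e0 ba1).
  rewrite -{2}[e / _]mulr1 -mulrDr divfK ?gt_eqF//; lra.
move=> e0; have [d d0 acd] := acg e e0.
have muN : mu N = 0 by exact: N0.
have muNoo : (mu N < +oo)%E by rewrite muN.
have [V [oO NO Od]] := lebesgue_regularity_outer mN muNoo d0.
have mO : measurable V by exact: open_measurable.
have muO : (mu V < d%:E)%E.
  apply: le_lt_trans Od; rewrite -[leRHS]adde0 -muN.
  rewrite -[in leLHS](setDUK NO) setUC measureU2//; exact: measurableD.
(* good c: the walk has reached c, with n recorded intervals ]s k, t k[, listed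
   from left to right. *)
pose good c := exists n (s t : nat -> R),
  [/\ forall k, (k < n)%N -> [/\ a <= s k, s k <= t k, t k <= c &
        `]s k, t k[ `<=` V],
      forall j k, (j < k < n)%N -> t j <= s k &
      g c - g a <= e * (c - a) + \sum_(k < n) `|g (t k) - g (s k)|].
have [] : good b.
  apply: (@segment_ind _ a) => //.
    exists 0%N, (fun=> 0), (fun=> 0); split => //.
    by rewrite big_ord0 !subrr mulr0 addr0.
  move=> c /andP[ac cb].
  have [Nc|Nc] := pselect (N c).
    have /nbhs_ballP[r /= r0 rO] : nbhs c V.
      by apply: open_nbhs_nbhs; split => //; exact: NO.
    exists r => // u v au uc cv vb ru vr [n [s [t [st1 st2 st3]]]].
    exists n.+1, (fun k => if k == n then u else s k),
      (fun k => if k == n then v else t k); split.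
    - move=> k; rewrite ltnS leq_eqVlt; case: eqVneq => [_ _|_ /= /st1[? ? ? ?]].
        split; [by []|lra|by []|move=> x; rewrite /= in_itv/= => /andP[ux xv]].
        by apply: rO; rewrite /ball/= ltr_norml; lra.
      by split => //; lra.
    - move=> j k /andP[jk]; rewrite ltnS leq_eqVlt; case: eqVneq jk => [->|kn] jk /= kltn.
        by rewrite ltn_eqF//; have [_ _ ? _] := st1 j jk; lra.
      by rewrite ltn_eqF ?(ltn_trans jk)//; apply: st2; rewrite jk.
    - rewrite big_ord_recr/= eqxx.
      under eq_bigr => k _ do rewrite ltn_eqF//.
      have := ler_norm (g v - g u).
      have : 0 <= e * (v - u) by rewrite mulr_ge0; lra.
      lra.
  have acb : a <= c <= b by rewrite ac cb.
  have /contrapT/(_ acb)[l l0 /(is_derive_le0_near e0 l0)[r r0 gr]] :=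
    contra_not (sN c) Nc.
  exists r => // u v au uc cv vb ru vr [n [s [t [st1 st2 st3]]]].
  exists n, s, t; split => //.
    by move=> k /st1[? ? ? ?]; split => //; lra.
  by have := gr u v uc cv ru vr; lra.
move=> n [s [t [st1 st2 st3]]].
pose s' (k : 'I_n) := s k; pose t' (k : 'I_n) := t k.
have st1' k : [/\ a <= s' k, s' k <= t' k, t' k <= b & `]s' k, t' k[ `<=` V].
  exact: st1.
have tI : trivIset setT (fun k => `]s' k, t' k[%classic).
  apply/trivIsetP => j k _ _; wlog jk : j k / (j < k)%N => [hw|].
    rewrite neq_ltn => /orP[jk|kj]; first by apply: hw => //; rewrite neq_ltn jk.
    by rewrite setIC; apply: hw => //; rewrite neq_ltn kj.
  move=> _; rewrite -subset0 => x [] /=; rewrite !in_itv/= => /andP[_ xt] /andP[sx _].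
  have := st2 j k; rewrite jk ltn_ord => /(_ isT).
  by rewrite /s' /t' in xt sx; lra.
have le_d : \sum_k (t' k - s' k) < d.
  rewrite -lte_fin (le_lt_trans _ muO)//; apply: sum_disjoint_itv_le => // k.
  - by have [] := st1' k.
  - by have [] := st1' k.
have := acd n s' t' _ tI le_d => /(_ _)/ltW acn.
rewrite (le_trans st3)// lerD2l acn// => k.
by have [] := st1' k.
Qed.
End AbsolutelyContinuous.

(** * The projected flow in a box: existence *)

Section BoxProjection.
Context {R : realType}.

Lemma itv_drift_pythagoras (lo hi x d z : R) :
  (x <= lo -> 0 <= z) -> (hi <= x -> z <= 0) ->
  (d - itv_drift lo hi x d) ^+ 2 + (itv_drift lo hi x d - z) ^+ 2 <= (d - z) ^+ 2.
Proof.
move=> zlo zhi; suff : 0 <= (d - itv_drift lo hi x d) * (itv_drift lo hi x d - z).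
  have -> : (d - z) ^+ 2 = (d - itv_drift lo hi x d) ^+ 2
    + (itv_drift lo hi x d - z) ^+ 2
    + 2 * ((d - itv_drift lo hi x d) * (itv_drift lo hi x d - z)) by ring.
  by move=> ?; rewrite lerDl mulr_ge0.
rewrite /itv_drift; have [x_hi|hi_x] := leP hi x; have [x_lo|lo_x] := leP x lo.
- have -> : z = 0 by apply/eqP; rewrite eq_le zlo// zhi.
  by rewrite min_r ?le_max ?lexx ?orbT// subrr mulr0.
- have := zhi x_hi; have [d0|d0] := leP d 0; first by rewrite subrr mul0r.
  by move=> z0; rewrite mulr_ge0//; lra.
- have := zlo x_lo; have [d0|d0] := leP 0 d.
    by rewrite subrr mul0r.
  by move=> z0; rewrite mulr_le0//; lra.
- by rewrite subrr mul0r.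
Qed.

Variables (m : nat) (lo hi : 'rV[R]_m).

Definition box_drift (v d : 'rV[R]_m) : 'rV[R]_m :=
  \row_i itv_drift (lo ord0 i) (hi ord0 i) (v ord0 i) (d ord0 i).

Lemma tangent_box_sign v w : box lo hi v -> tangent_cone (box lo hi) v w ->
  forall i, (v ord0 i <= lo ord0 i -> 0 <= w ord0 i) /\
            (hi ord0 i <= v ord0 i -> w ord0 i <= 0).
Proof.
move=> bv tw i.
have near_w e : 0 < e -> exists (d : R) s, [/\ 0 < d, box lo hi s &
    `|w ord0 i - d^-1 * (s ord0 i - v ord0 i)| < e].
  move=> e0; have [u [[d d0 [s bs <-]] wu]] := tw _ (nbhsx_ballx w e e0).
  exists d, s; split => //; apply: le_lt_trans (_ : `|w - d^-1 *: (s - v)| < e).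
    by have := coord_norm_le (w - d^-1 *: (s - v)) i; rewrite !mxE.
  by move: wu; rewrite -ball_normE.
split=> vb; rewrite leNgt; apply/negP => w0.
- have [|d [s [d0 bs]]] := near_w (- w ord0 i); first by rewrite oppr_gt0.
  have : 0 <= d^-1 * (s ord0 i - v ord0 i).
    rewrite mulr_ge0 ?invr_ge0 ?(ltW d0)// subr_ge0 (le_trans vb)//.
    by have /andP[] := bs i.
  by rewrite ltr_norml; lra.
- have [|d [s [d0 bs]]] := near_w (w ord0 i); first by [].
  have : d^-1 * (s ord0 i - v ord0 i) <= 0.
    rewrite mulr_ge0_le0 ?invr_ge0 ?(ltW d0)// subr_le0 (le_trans _ vb)//.
    by have /andP[] := bs i.
  by rewrite ltr_norml; lra.
Qed.

Lemma box_drift_tangent v d : (forall i, lo ord0 i <= hi ord0 i) ->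
  box lo hi v -> tangent_cone (box lo hi) v (box_drift v d).
Proof.
move=> lohi bv; apply: subset_closure.
have step i : \forall s \near 0^'+,
    clamp (lo ord0 i) (hi ord0 i) (v ord0 i + s * d ord0 i) - v ord0 i =
    s * box_drift v d ord0 i.
  by rewrite mxE; exact: clamp_itv_drift.
have /filter_ex[s [s0 sP]] : \forall s \near (0:R)^'+, 0 < s /\ forall i,
    clamp (lo ord0 i) (hi ord0 i) (v ord0 i + s * d ord0 i) - v ord0 i =
    s * box_drift v d ord0 i.
  by near=> s; split => //; near: s; exact: filter_forall.
exists s => //.
exists (\row_i clamp (lo ord0 i) (hi ord0 i) (v ord0 i + s * d ord0 i)).
  by move=> i; rewrite mxE clamp_itv.
by apply/rowP => i; rewrite !mxE sP mulKf ?gt_eqF// mxE.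
Unshelve. all: by end_near. Qed.

(** The cone is a product of half-lines, lines and points, so the projection is
    coordinatewise; the Pythagorean inequality yields minimality and
    uniqueness at once. *)
Lemma proj_tangent_box v d : (forall i, lo ord0 i <= hi ord0 i) ->
  box lo hi v -> proj_tangent (box lo hi) v d = box_drift v d.
Proof.
move=> lohi bv; have bt := @box_drift_tangent v d lohi bv.
have pyth z : tangent_cone (box lo hi) v z ->
    dotv (d - box_drift v d) (d - box_drift v d) +
    dotv (box_drift v d - z) (box_drift v d - z) <= dotv (d - z) (d - z).
  move=> tz; rewrite /dotv -big_split/=; apply: ler_sum => i _.
  rewrite !mxE -!expr2; have [zlo zhi] := tangent_box_sign bv tz i.
  exact: itv_drift_pythagoras.
apply: get_unique; first split => // z tz.
  rewrite /enorm ler_sqrt ?dotv_ge0//; apply: le_trans (pyth z tz).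
  by rewrite lerDl dotv_ge0.
move=> z [tz zmin]; have := zmin _ bt; rewrite /enorm ler_sqrt ?dotv_ge0// => zle.
have /eqP : dotv (box_drift v d - z) (box_drift v d - z) = 0.
  by apply/eqP; rewrite eq_le dotv_ge0 andbT; have := pyth z tz; lra.
rewrite psumr_eq0 => [/allP z0|i _]; last by rewrite -expr2 sqr_ge0.
apply/rowP => i; have := z0 i; rewrite mem_index_enum => /(_ isT)/=.
by rewrite -expr2 sqrf_eq0 [X in X == _]mxE [X in _ + X]mxE subr_eq0 => /eqP.
Qed.

Lemma box_drift_obtuse v d z : box lo hi z ->
  dotv (box_drift v d - d) (v - z) <= 0.
Proof.
by move=> bz; apply: sumr_le0 => i _; rewrite !mxE; exact: itv_drift_obtuse.
Qed.

End BoxProjection.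

Lemma box_flow_exists (R : realType) (m : nat) (lo hi : 'rV[R]_m)
    (F : 'rV[R]_m -> 'rV[R]_m) (L M : R) (v0 : 'rV[R]_m) :
  (forall i, lo ord0 i <= hi ord0 i) -> 0 <= L -> 0 <= M ->
  (forall u v, box lo hi u -> box lo hi v -> `|F u - F v| <= L * `|u - v|) ->
  (forall u, box lo hi u -> `|F u| <= M) -> box lo hi v0 ->
  exists v, solution (fun _ z => proj_tangent (box lo hi) z (F z))
    (box lo hi) v0 v.
Proof.
move=> lohi L0 M0 F_lip F_bound bv0.
have [v [v_le0 v_box v_lip v_step]] := euler_limit lohi L0 M0 F_lip F_bound bv0.
exists v; split => //; first exact: v_le0.
  move=> T T0 e e0; have M1 : 0 < M + 1 by rewrite ltr_wpDl.
  exists (e / (M + 1)); first exact: divr_gt0.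
  move=> N s t st _; rewrite ltr_pdivlMr// => sumd.
  apply: le_lt_trans sumd; rewrite mulr_suml ler_sum// => k _.
  have [_ stk _] := st k; rewrite (le_trans (v_lip _ _))//.
  by rewrite ger0_norm ?subr_ge0// mulrC ler_wpM2l ?subr_ge0// lerDl.
(* The curve rests at v0 before time 0, so its right derivative is 0 there. *)
pose D i (t : R) := if t < 0 then 0 else box_drift lo hi (v t) (F (v t)) ord0 i.
have inv_right (P : R -> Prop) : (\forall s \near 0^'+, P s) ->
    \forall n \near \oo, P n.+1%:R^-1.
  move=> P0; have [N _ NP] := @cvg_harmonic R _ P0.
  by exists N => // n Nn; apply: (NP n Nn); exact: harmonic_gt0.
have D_right i t : n.+1%:R * (v (t + n.+1%:R^-1) ord0 i - v t ord0 i)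
    @[n --> \oo] --> D i t.
  rewrite /D; apply/cvgrPdist_le => e e0; have [t0|t0] := ltP t 0.
    near=> n; rewrite !v_le0 ?subrr ?mulr0 ?subrr ?normr0 ?ltW//.
    rewrite -ltrBrDl sub0r; near: n.
    by apply: (inv_right (fun s => s < - t)); apply: nbhs_right_lt; rewrite oppr_gt0.
  have near_p : \forall n \near \oo, clamp (lo ord0 i) (hi ord0 i)
      (v t ord0 i + n.+1%:R^-1 * F (v t) ord0 i) - v t ord0 i =
      n.+1%:R^-1 * box_drift lo hi (v t) (F (v t)) ord0 i.
    rewrite mxE; apply: (inv_right (fun s => clamp (lo ord0 i) (hi ord0 i)
      (v t ord0 i + s * F (v t) ord0 i) - v t ord0 i = s * _)).
    exact: clamp_itv_drift (v_box t i).
  near=> n; have n0 : 0 < n.+1%:R^-1 :> R by [].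
  have cp := near near_p n; set p := box_drift _ _ _ _ _ _ in cp *.
  have -> : p = n.+1%:R * (n.+1%:R^-1 * p) by rewrite mulVKf.
  rewrite -cp// -mulrBr normrM ger0_norm// distrC opprB addrA subrK.
  have := le_trans (coord_norm_le _ i) (v_step _ _ t0 (ltW n0)); rewrite !mxE => vs.
  rewrite (le_trans (ler_wpM2l _ vs))// mulrCA expr2 mulVKf// mulrC.
  rewrite (@le_trans _ _ (n.+1%:R^-1 * (L * M + 1)))//.
    by rewrite ler_wpM2l// lerDl.
  rewrite -ler_pdivlMr; last by rewrite ltr_wpDl// mulr_ge0.
  near: n; apply: (inv_right (fun s => s <= e / (L * M + 1))).
  by apply: nbhs_right_le; rewrite divr_gt0// ltr_wpDl// mulr_ge0.
have ae_i i : {ae lebesgue_measure, forall t : R, -1 < t ->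
    is_derive t 1 (fun s => v s ord0 i) (D i t)}.
  apply: (@lipschitz_ae_is_derive _ _ _ M) => // s t.
  rewrite (le_trans _ (v_lip s t))//.
  by have := coord_norm_le (v t - v s) i; rewrite !mxE.
have : {ae lebesgue_measure, forall t : R, forall i, -1 < t ->
    is_derive t 1 (fun s => v s ord0 i) (D i t)}.
  by apply: filter_forall.
apply: filterS; first exact: (ae_filter_ringOfSetsType lebesgue_measure).
move=> t vt t0.
have vt' i : is_derive t 1 (fun s => v s ord0 i)
    (box_drift lo hi (v t) (F (v t)) ord0 i).
  by have := vt i; rewrite /D (le_gtF t0); apply; lra.
rewrite proj_tangent_box//.
have dv : derivable v t 1.
  by apply/derivable_mxP => j i; rewrite ord1; have [] := vt' i.
apply: DeriveDef => //; rewrite derive_mx//; apply/rowP => i.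
by rewrite mxE; have [_ ->] := vt' i.
Unshelve. all: by end_near. Qed.

(** * The projected flow in a box: energy, uniqueness, convergence *)

Section Energy.
Context {R : realType} {m : nat}.
Implicit Types u v : 'rV[R]_m.

Lemma continuous_dotv {T : topologicalType} (f g : T -> 'rV[R]_m) :
  continuous f -> continuous g -> continuous (fun t => dotv (f t) (g t)).
Proof.
move=> cf cg t; apply: cvg_big => [|i _]; first exact: add_continuous.
have coord (h : T -> 'rV[R]_m) : continuous h ->
      h s ord0 i @[s --> t] --> h t ord0 i.
  move=> ch; apply: (cvg_comp h (fun x : 'rV[R]_m => x ord0 i) (ch t)).
  exact: coord_continuous.
by apply: (@cvgM R T (nbhs t)); exact: coord.
Qed.

Lemma is_derive_dotv (w : R -> 'rV[R]_m) (t : R) (dw : 'rV[R]_m) :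
  is_derive t 1 w dw ->
  is_derive t 1 (fun s => dotv (w s) (w s)) (2 * dotv (w t) dw).
Proof.
move=> [dwt <-].
have di i : is_derive t 1 (fun s => w s ord0 i) ('D_1 w t ord0 i).
  apply: DeriveDef; first by move/derivable_mxP : dwt; apply.
  by rewrite derive_mx// mxE.
have -> : (fun s => dotv (w s) (w s)) =
    \sum_(i < m) (fun s => w s ord0 i) * (fun s => w s ord0 i).
  by apply/funext => s; rewrite fct_sumE.
apply: (is_derive_eq (is_derive_sum (fun i => is_deriveM (di i) (di i)))).
by rewrite /dotv mulr_sumr; apply: eq_bigr => i _; rewrite /GRing.scale/=; ring.
Qed.

Lemma ac_fun_lip a b (w : R -> 'rV[R]_m) (g : R -> R) (A B : R) :
  0 <= A -> 0 <= B -> abs_continuous a b w ->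
  (forall s t, a <= s -> s <= t -> t <= b ->
    `|g t - g s| <= A * `|w t - w s| + B * (t - s)) ->
  ac_fun a b g.
Proof.
move=> A0 B0 acw gw e e0.
have A1 : 0 < 2 * (A + 1) by rewrite mulr_gt0// ltr_wpDl.
have B1 : 0 < 2 * (B + 1) by rewrite mulr_gt0// ltr_wpDl.
have [d d0 dP] := acw _ (divr_gt0 e0 A1).
exists (Num.min d (e / (2 * (B + 1)))).
  by rewrite lt_min d0 divr_gt0.
move=> N s t st tI; rewrite lt_min => /andP[sd sB].
have := dP N s t st tI sd; set Sw := \sum_k _ => Sw_lt.
have Sw0 : 0 <= Sw by apply: sumr_ge0.
rewrite (@le_lt_trans _ _ (A * Sw + B * \sum_k (t k - s k)))//.
  rewrite !mulr_sumr -big_split ler_sum// => k _.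
  by have [? ? ?] := st k; exact: gw.
move: Sw_lt sB; rewrite !ltr_pdivlMr//; set St := \sum_k _ => h1 h2.
have St0 : 0 <= St by apply: sumr_ge0 => k _; rewrite subr_ge0; have [] := st k.
lra.
Qed.

Lemma dotv_diff_le u v K : `|u| <= K -> `|v| <= K ->
  `|dotv u u - dotv v v| <= m%:R * (2 * K) * `|u - v|.
Proof.
move=> uK vK.
have -> : dotv u u - dotv v v = dotv (u - v) (u + v).
  by rewrite dotvBl !(dotvC _ (u + v)) !dotvDl (dotvC v u); ring.
rewrite (le_trans (dotv_norm_le _ _))// -mulrA ler_wpM2l// mulrC ler_wpM2r//.
by rewrite (le_trans (ler_normD _ _))//; lra.
Qed.

(** The form in which solutions enter: w is a difference of two solutions, or
    the deviation of one solution from the equilibrium. *)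
Lemma energy_decay a b (w : R -> 'rV[R]_m) (K c : R) : a <= b ->
  abs_continuous a b w -> (forall t, a <= t <= b -> `|w t| <= K) -> 0 <= c ->
  {ae lebesgue_measure, forall t, a <= t <= b ->
     exists2 dw, is_derive t 1 w dw & 2 * dotv (w t) dw <= - c} ->
  dotv (w b) (w b) + c * (b - a) <= dotv (w a) (w a).
Proof.
move=> ab acw wK c0 dw.
have K0 : 0 <= K by rewrite (le_trans _ (wK a _))// lexx ab.
suff : dotv (w b) (w b) + c * b <= dotv (w a) (w a) + c * a by lra.
apply: (@ac_nonincreasing _ a b (fun t => dotv (w t) (w t) + c * t)) => //.
  apply: (@ac_fun_lip _ _ w _ (m%:R * (2 * K)) c) => //.
    by rewrite !mulr_ge0.
  move=> s t as_ st tb; rewrite opprD addrACA -mulrBr (le_trans (ler_normD _ _))//.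
  apply: lerD; last by rewrite normrM !ger0_norm// subr_ge0.
  by apply: dotv_diff_le; apply: wK; lra.
apply: filterS dw; first exact: (ae_filter_ringOfSetsType lebesgue_measure).
move=> t dw tab; have [l wl lc] := dw tab.
exists (2 * dotv (w t) l + c); first by lra.
apply: is_deriveD; first exact: is_derive_dotv.
have := @is_deriveZ R R R id c t 1 1 (is_derive_id _ _).
by rewrite [c *: 1]mulr1.
Qed.

End Energy.

Section Box.
Context {R : realType} {m : nat}.
Variables lo hi : 'rV[R]_m.

Lemma box_compact : compact (box lo hi).
Proof.
have -> : box lo hi =
    [set v | forall i, `[lo ord0 i, hi ord0 i]%classic (v ord0 i)].
  by apply/seteqP; split => v bv i; have := bv i; rewrite /= in_itv.
apply: (@rV_compact _ _ (fun i => `[lo ord0 i, hi ord0 i]%classic)) => i.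
exact: segment_compact.
Qed.

(** By compactness, W has a positive minimum on the points of the box at
    Euclidean distance at least sqrt e from vs. *)
Lemma positive_gap (W : 'rV[R]_m -> R) (vs : 'rV[R]_m) (e : R) :
  continuous W -> (forall v, box lo hi v -> v <> vs -> 0 < W v) -> 0 < e ->
  exists2 w, 0 < w & forall v, box lo hi v -> W v < w ->
    dotv (v - vs) (v - vs) < e.
Proof.
move=> cW Wpos e0.
pose K := box lo hi `&` [set v | e <= dotv (v - vs) (v - vs)].
have cK : compact K.
  apply: compact_closedI; first exact: box_compact.
  have cV : continuous (fun v : 'rV[R]_m => dotv (v - vs) (v - vs)).
    have cB : continuous (fun v : 'rV[R]_m => v - vs).
      by move=> v; apply: (@cvgB R _ _ (nbhs v)); [exact: cvg_id|exact: cvg_cst].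
    exact: continuous_dotv.
  exact: (preimage_closed (fun v _ => cV v) (@closed_ge R e)).
have [[v0 Kv0]|K0] := pselect (K !=set0); last first.
  exists 1 => // v bv _; rewrite ltNge; apply/negP => ve.
  by apply: K0; exists v.
have [|c cin cmin] := EVT_min_rV _ cK (continuous_subspaceT cW); first by exists v0.
have [bc ec] : K c by move: cin; rewrite inE.
exists (W c).
  apply: Wpos => // cvs; move: ec => /=.
  by rewrite cvs subrr dotv0l leNgt e0.
move=> v bv Wv; rewrite ltNge; apply/negP => ve.
by have := cmin v; rewrite inE => /(_ (conj bv ve)); rewrite leNgt Wv.
Qed.

Lemma abs_continuousB a b (x y : R -> 'rV[R]_m) :
  abs_continuous a b x -> abs_continuous a b y ->
  abs_continuous a b (fun t => x t - y t).
Proof.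
move=> acx acy e e0.
have e2 : 0 < e / 2 by rewrite divr_gt0.
have [d d0 dP] := acx _ e2; have [d' d0' dP'] := acy _ e2.
exists (Num.min d d'); first by rewrite lt_min d0.
move=> N s t st tI; rewrite lt_min => /andP[sd sd'].
have := dP N s t st tI sd; have := dP' N s t st tI sd'.
suff : \sum_k `|x (t k) - y (t k) - (x (s k) - y (s k))| <=
  \sum_k `|x (t k) - x (s k)| + \sum_k `|y (t k) - y (s k)| by lra.
rewrite -big_split ler_sum// => k _.
have -> : x (t k) - y (t k) - (x (s k) - y (s k)) =
  x (t k) - x (s k) - (y (t k) - y (s k)).
  by rewrite !opprB addrACA [- y _ + _]addrC addrACA.
exact: ler_normB.
Qed.

Lemma abs_continuousS a b a' b' (x : R -> 'rV[R]_m) : a <= a' -> b' <= b ->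
  abs_continuous a b x -> abs_continuous a' b' x.
Proof.
move=> aa bb acx e e0; have [d d0 dP] := acx e e0; exists d => //.
move=> N s t st; apply: dP => k; have [? ? ?] := st k.
by split => //; [exact: le_trans aa _|exact: le_trans bb].
Qed.

Lemma abs_continuous_cst a b (c : 'rV[R]_m) : abs_continuous a b (fun=> c).
Proof.
move=> e e0; exists 1 => // N s t _ _ _.
by rewrite big1// => k _; rewrite subrr normr0.
Qed.

Lemma box_bounded : exists K, forall u v, box lo hi u -> box lo hi v -> `|u - v| <= K.
Proof.
exists `|hi - lo| => u v bu bv; apply: row_norm_le => // i.
apply: le_trans (coord_norm_le (hi - lo) i); rewrite !mxE.
apply: le_trans (ler_norm _).
by have := bu i; have := bv i; rewrite ler_norml; lra.
Qed.

Variable F : 'rV[R]_m -> 'rV[R]_m.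
Hypothesis lohi : forall i, lo ord0 i <= hi ord0 i.

Let vel v := proj_tangent (box lo hi) v (F v).
Let sol := solution (fun _ => vel) (box lo hi).

(** The corrections made by the projection at x and at y both pull the two
    points together, so the monotonicity of - F survives projection. *)
Lemma box_flow_unique v0 x y :
  (forall u v, box lo hi u -> box lo hi v -> dotv (F u - F v) (u - v) <= 0) ->
  sol v0 x -> sol v0 y -> forall t, 0 <= t -> x t = y t.
Proof.
move=> F_mono [x0 bx acx dx] [y0 by_ acy dy] T T0.
have [K KP] := box_bounded.
have decay : dotv (x T - y T) (x T - y T) + 0 * (T - 0) <=
    dotv (x 0 - y 0) (x 0 - y 0).
  apply: (@energy_decay _ _ 0 T (fun t => x t - y t) K) => //.
  - by apply: abs_continuousB; [exact: acx|exact: acy].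
  - by move=> t /andP[t0 _]; apply: KP; [exact: bx|exact: by_].
  move: dx dy; apply: filterS2; first exact: (ae_filter_ringOfSetsType lebesgue_measure).
  move=> t dx dy /andP[t0 _]; have bxt := bx t t0; have byt := by_ t t0.
  exists (vel (x t) - vel (y t)); first by apply: is_deriveB; [exact: dx|exact: dy].
  rewrite oppr0 /vel !proj_tangent_box// dotvC.
  have := box_drift_obtuse (x t) (F (x t)) byt.
  have := box_drift_obtuse (y t) (F (y t)) bxt.
  have := F_mono _ _ bxt byt.
  by rewrite !dotvBl !dotvBr; lra.
move: decay; rewrite x0 y0 subrr mul0r addr0 dotv0l => decay.
have : `|x T - y T| <= 0.
  by apply: norm_le_dotv => //; rewrite expr0n.
by rewrite normr_le0 subr_eq0 => /eqP.
Qed.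

(** W is a Lyapunov rate: the squared distance to vs decreases at least at speed
    2 W.  It cannot decrease at a positive speed for ever, so W gets below the
    threshold of positive_gap at some time T; the distance being nonincreasing,
    it stays small from then on. *)
Lemma box_flow_converges (W : 'rV[R]_m -> R) vs v0 v :
  box lo hi vs -> continuous W -> 0 <= W vs ->
  (forall u, box lo hi u -> u <> vs -> 0 < W u) ->
  (forall u, box lo hi u -> dotv (F u) (u - vs) <= - W u) ->
  sol v0 v -> v t @[t --> +oo] --> vs.
Proof.
move=> bvs cW Wvs Wpos FW [v_0 bv acv dv].
have W0 u : box lo hi u -> 0 <= W u.
  by move=> bu; have [->//|/eqP uvs] := eqVneq u vs; exact/ltW/Wpos.
have [K KP] := box_bounded.
pose V t := dotv (v t - vs) (v t - vs).
have decay a b c : 0 <= a -> a <= b -> 0 <= c ->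
    (forall t, a <= t <= b -> c <= W (v t)) -> V b + 2 * c * (b - a) <= V a.
  move=> a0 ab c0 cP.
  apply: (@energy_decay _ _ a b (fun t => v t - vs) K) => //.
  - apply: abs_continuousB; last exact: abs_continuous_cst.
    by apply: (@abs_continuousS 0 b) => //; apply: acv; exact: le_trans ab.
  - by move=> t tab; apply: KP => //; apply: bv; lra.
  - by rewrite mulr_ge0.
  move: dv; apply: filterS; first exact: (ae_filter_ringOfSetsType lebesgue_measure).
  move=> t dv tab; have t0 : 0 <= t by lra.
  have bvt := bv t t0.
  exists (vel (v t)).
    rewrite -[vel _]subr0; apply: is_deriveB; first exact: dv.
  rewrite /vel !proj_tangent_box// dotvC.
  have := box_drift_obtuse (v t) (F (v t)) bvs.
  have := FW _ bvt; have := cP t tab.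
  by rewrite !dotvBl; lra.
apply/cvgrPdist_le => e e0.
have [w w0 wP] := positive_gap cW Wpos (exprn_gt0 2 e0).
have [T T0 WT] : exists2 T, 0 <= T & W (v T) < w.
  apply: contrapT => noT.
  have V0 : 0 <= V 0 by exact: dotv_ge0.
  (* At this time the decrease 2 w T exceeds the initial energy V 0. *)
  pose T := V 0 / w + 1.
  have T0 : 0 <= T by rewrite addr_ge0// divr_ge0// ltW.
  have := decay 0 T w (lexx _) T0 (ltW w0) _.
  have -> : 2 * w * (T - 0) = 2 * V 0 + 2 * w.
    by rewrite /T; field; rewrite gt_eqF.
  have VT : 0 <= V T by exact: dotv_ge0.
  move=> H; have : V T + (2 * V 0 + 2 * w) <= V 0; last by lra.
  apply: H => t /andP[t0 _]; rewrite leNgt; apply/negP => Wt.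
  by apply: noT; exists t.
have VT : V T < e ^+ 2 by apply: wP => //; exact: bv.
near=> t.
have Tt : T <= t by near: t; apply: nbhs_pinfty_ge; exact: num_real.
have := decay T t 0 T0 Tt (lexx _) _; rewrite mulr0 mul0r addr0 => dT.
rewrite distrC; apply: norm_le_dotv; first exact: ltW.
apply: le_trans (ltW VT); apply: dT => s /andP[Ts _].
by apply: W0; apply: bv; exact: le_trans Ts.
Unshelve. all: by end_near. Qed.

End Box.

(** * Strictly convex functions on a box *)

Section Convex.
Context {R : realType} {m : nat}.
Implicit Types (u v w : 'rV[R]_m) (h : 'rV[R]_m -> R).

Lemma derive_dotv_grad h v w : differentiable h v -> 'D_w h v = dotv (grad h v) w.
Proof.
move=> dh; rewrite deriveE// {1}(row_sum_delta w) linear_sum.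
apply: eq_bigr => i _; rewrite linearZ /grad mxE deriveE//.
by rewrite /GRing.scale/= mulrC.
Qed.

(** The secant slopes of h from v towards u are all at most h u - h v, and their
    limit is the derivative of h at v along u - v. *)
Lemma convex_grad_le h u v : differentiable h v -> strictly_convex h ->
  dotv (grad h v) (u - v) <= h u - h v.
Proof.
move=> dh ch; rewrite -derive_dotv_grad//.
have [->|/eqP uv] := eqVneq u v; first by rewrite subrr derive0 subrr.
have /cvg_dnbhs_at_right dq : t^-1 *: (h (t *: (u - v) + v) - h v) @[t --> 0^'] -->
    'D_(u - v) h v by exact: (@diff_derivable _ _ _ h v (u - v) dh).
apply: (cvgr_to_le dq); near=> t.
have t0 : 0 < t by [].
have t1 : t < 1 by near: t; apply: nbhs_right_lt.
have -> : t *: (u - v) + v = t *: u + (1 - t) *: v.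
  by rewrite scalerBr scalerBl scale1r -addrA [- _ + _]addrC.
have := ch u v t uv t0 t1 => hlt.
by rewrite /GRing.scale/= ler_pdivrMl//; lra.
Unshelve. all: by end_near. Qed.

Lemma convex_grad_monotone h u v : (forall x, differentiable h x) ->
  strictly_convex h -> 0 <= dotv (grad h u - grad h v) (u - v).
Proof.
move=> dh ch; have := convex_grad_le u (dh v) ch.
have := convex_grad_le v (dh u) ch.
by rewrite !dotvBl !dotvBr; lra.
Qed.

Variables lo hi : 'rV[R]_m.
Hypothesis lohi : forall i, lo ord0 i <= hi ord0 i.

Lemma box_lo : box lo hi lo.
Proof. by move=> i; rewrite lexx lohi. Qed.

(** Two minimizers would have a midpoint with a smaller value. *)
Lemma box_argmin h : continuous h -> strictly_convex h ->
  exists2 vs, box lo hi vs & forall v, box lo hi v -> v <> vs -> h vs < h v.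
Proof.
move=> hc ch; have [|vs] :=
  EVT_min_rV _ (@box_compact _ _ lo hi) (continuous_subspaceT hc).
  by exists lo; exact: box_lo.
rewrite inE => bvs vsmin; exists vs => // v bv vvs.
have := ch _ _ 2^-1 vvs; rewrite invr_gt0 ltr0n invf_lt1// ltr1n => /(_ isT isT).
set w := _ + _ => hw.
have bw : box lo hi w.
  by move=> i; have := bv i; have := bvs i; rewrite !mxE; lra.
by have := vsmin w; rewrite inE => /(_ bw); lra.
Qed.

Lemma box_gradient_flow h (a L M : R) vs v0 : 0 < a ->
  (forall x, differentiable h x) -> strictly_convex h -> 0 <= L -> 0 <= M ->
  (forall u v, box lo hi u -> box lo hi v ->
    `|- (a *: grad h u) - - (a *: grad h v)| <= L * `|u - v|) ->
  (forall u, box lo hi u -> `|- (a *: grad h u)| <= M) ->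
  box lo hi vs -> (forall v, box lo hi v -> v <> vs -> h vs < h v) ->
  box lo hi v0 ->
  let vel v := proj_tangent (box lo hi) v (- (a *: grad h v)) in
  unique_solution (fun _ => vel) (box lo hi) v0 /\
  forall v : R -> 'rV[R]_m, solution (fun _ => vel) (box lo hi) v0 v ->
    v t @[t --> +oo] --> vs.
Proof.
move=> a0 dh ch L0 M0 GL GM bvs vsmin bv0 vel; split; first split.
- exact: (box_flow_exists (F := fun v => - (a *: grad h v)) lohi L0 M0 GL GM bv0).
- move=> x y solx soly.
  apply: (box_flow_unique (F := fun v => - (a *: grad h v)) lohi _ solx soly).
  move=> u v _ _; have := mulr_ge0 (ltW a0) (convex_grad_monotone u v dh ch).
  by rewrite !(dotvBl, dotvNl, dotvZl); lra.
have ch_cont : continuous h by move=> v; exact: differentiable_continuous.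
move=> x solx.
apply: (box_flow_converges (F := fun v => - (a *: grad h v))
  (W := fun v => a * (h v - h vs)) lohi bvs _ _ _ _ solx).
- move=> v; apply: (@cvgM R _ (nbhs v)); first exact: cvg_cst.
  by apply: (@cvgB R _ _ (nbhs v)); [exact: ch_cont|exact: cvg_cst].
- by rewrite subrr mulr0.
- by move=> u bu uvs; rewrite mulr_gt0// subr_gt0; exact: vsmin.
- move=> u bu; rewrite dotvNl dotvZl lerN2 ler_pM2l//.
  have := convex_grad_le vs (dh u) ch.
  by rewrite !dotvBr; lra.
Qed.

(** The perturbation dotv (B v) (Q y - Q x) is uniformly small for v in the box,
    so k y almost minimizes the objective at x. *)
Lemma argmin_continuous {T : topologicalType} (p : nat) (A : 'rV[R]_m -> R)
    (B : 'rV[R]_m -> 'rV[R]_p) (Q : T -> 'rV[R]_p) (k : T -> 'rV[R]_m) :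
  continuous A -> continuous B -> continuous Q ->
  (forall x, box lo hi (k x)) ->
  (forall x v, box lo hi v -> v <> k x ->
    A (k x) + dotv (B (k x)) (Q x) < A v + dotv (B v) (Q x)) ->
  continuous k.
Proof.
move=> cA cB cQ bk kmin x.
have [|c _ cmax] := EVT_max_rV _ (@box_compact _ _ lo hi)
    (continuous_subspaceT (fun v => cvg_norm (cB v))).
  by exists lo; exact: box_lo.
have Bc v : box lo hi v -> `|B v| <= `|B c| by move=> bv; apply: cmax; rewrite inE.
have C0 : 0 < p%:R * `|B c| + 1 by rewrite ltr_wpDl// mulr_ge0.
pose W v := A v + dotv (B v) (Q x) - (A (k x) + dotv (B (k x)) (Q x)).
have cW : continuous W.
  move=> v; apply: (@cvgB R _ _ (nbhs v)); last exact: cvg_cst.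
  apply: (@cvgD R _ _ (nbhs v)); first exact: cA.
  have cQx : continuous (fun _ : 'rV[R]_m => Q x) by exact: cst_continuous.
  exact: (continuous_dotv cB cQx).
have Wpos v : box lo hi v -> v <> k x -> 0 < W v.
  by move=> bv vk; rewrite subr_gt0; exact: kmin.
apply/cvgrPdist_le => e e0.
have [w w0 wP] := positive_gap cW Wpos (exprn_gt0 2 e0).
have d0 : 0 < w / (4 * (p%:R * `|B c| + 1)) by rewrite divr_gt0// mulr_gt0.
near=> y; rewrite distrC; apply: norm_le_dotv; first exact: ltW.
apply/ltW/wP => //.
have Qy : `|Q y - Q x| < w / (4 * (p%:R * `|B c| + 1)).
  by rewrite distrC; near: y; apply: cvgr_dist_lt => //; exact: cQ.
have near_val v : box lo hi v -> `|dotv (B v) (Q y - Q x)| < w / 4.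
  move=> bv; apply: le_lt_trans (dotv_norm_le _ _) _.
  apply: (@le_lt_trans _ _ ((p%:R * `|B c| + 1) * `|Q y - Q x|)).
    rewrite mulrA ler_wpM2r// (@le_trans _ _ (p%:R * `|B c|)) ?lerDl//.
    by rewrite ler_wpM2l// Bc.
  by move: Qy; rewrite ltr_pdivlMr ?mulr_gt0//; lra.
have := near_val _ (bk y); have := near_val _ (bk x).
rewrite !ltr_norml !dotvBr /W => h1 h2.
have [->|/eqP kyx] := eqVneq (k y) (k x); first by lra.
by have := kmin y (k x) (bk x) (fun e => kyx (esym e)); lra.
Unshelve. all: by end_near. Qed.

End Convex.

(** * Regularity of the objective and the steady-state map *)

Section Regularity.
Context {R : realType}.

(** The hypothesis gives a Lipschitz bound near every pair of points, also of
    distinct ones, so a finite cover of K * K suffices: no path inside K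
    has to join them. *)
Lemma locally_lipschitz_compact (V W : normedModType R) (h : V -> W) (K : set V) :
  [locally [lipschitz h z | z in setT]] -> compact K ->
  exists2 L, 0 <= L & forall u v, K u -> K v -> `|h u - h v| <= L * `|u - v|.
Proof.
move=> hlip cK.
have /compact_near_coveringP cKK := compact_setX cK cK.
pose P (L : R) (z : V * V) := `|h z.1 - h z.2| <= L * `|z.1 - z.2|.
have near_P : \forall L \near +oo, K `*` K `<=` P L.
  apply: cKK => z _; have zT : (setT `*` setT) z by [].
  have [L [Lreal LP]] := hlip z zT.
  have [B nB BP] := LP (L + 1) (ltr_pwDr ltr01 (lexx L)).
  exists ([set z' | P (L + 1) z'], [set M | L + 1 <= M]) => /=.
    split; last by apply: nbhs_pinfty_ge; exact: num_real.
    by exists B => // z' Bz; exact: (BP z' Bz (conj I I)).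
  move=> [z' M] /= [Pz LM]; rewrite /P (le_trans Pz)//.
  by rewrite ler_wpM2r.
have [L [L0 LP]] : exists L : R, 0 <= L /\ K `*` K `<=` P L.
  have : \forall L \near +oo, 0 <= L /\ K `*` K `<=` P L.
    by near=> L; split; near: L => //; apply: nbhs_pinfty_ge; exact: num_real.
  by move/filter_ex.
by exists L => // u v Ku Kv; exact: (LP (u, v)).
Unshelve. all: by end_near. Qed.

Lemma locally_lipschitz_continuous (V W : normedModType R) (h : V -> W) :
  [locally [lipschitz h z | z in setT]] -> continuous h.
Proof.
move=> hlip x; have xT : (setT `*` setT) (x, x) by [].
have [L [Lreal LP]] := hlip (x, x) xT.
have [[B1 B2] /= [nB1 nB2] BP] := LP (L + 1) (ltr_pwDr ltr01 (lexx L)).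
have M1 : 0 < `|L + 1| + 1 by rewrite ltr_wpDl.
apply/cvgrPdist_le => e e0; near=> y.
have := BP (x, y); rewrite /= => /(_ _ _) H.
have /H : B1 x /\ B2 y by split; [exact: nbhs_singleton|near: y].
move=> /(_ xT)/le_trans; apply.
rewrite (@le_trans _ _ ((`|L + 1| + 1) * `|x - y|))//.
  by rewrite ler_wpM2r// (le_trans (ler_norm _))// lerDl.
rewrite mulrC -ler_pdivlMr//; near: y.
by apply: cvgr_dist_le => //; rewrite divr_gt0.
Unshelve. all: by end_near. Qed.

Lemma mulmx_norm_le a b (c : 'rV[R]_a) (A : 'M[R]_(a, b)) :
  `|c *m A| <= a%:R * (`|c| * `|A|).
Proof.
apply: row_norm_le => [|j]; first by rewrite !mulr_ge0.
rewrite mxE (le_trans (ler_norm_sum _ _ _))//.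
rewrite -[X in X%:R * _]card_ord -sumr_const mulr_suml ler_sum// => i _.
rewrite mul1r normrM ler_pM ?coord_norm_le//.
rewrite [leRHS]/Num.Def.normr/= mx_normrE.
exact: (le_bigmax 0 (fun ij => `|A ij.1 ij.2|) (i, j)).
Qed.

Lemma continuous_mulmxr a b (A : 'M[R]_(a, b)) :
  continuous (fun v : 'rV[R]_a => v *m A).
Proof.
apply: locally_lipschitz_continuous; apply: lipschitz_locally.
exists (a%:R * `|A|); split; first exact: num_real.
move=> M /ltW MA [u v] _ /=; rewrite -mulmxBl (le_trans (mulmx_norm_le _ _))//.
by rewrite mulrA mulrAC ler_wpM2r.
Qed.

Lemma differentiable_mulmxr a b (A : 'M[R]_(a, b)) v :
  differentiable (fun v : 'rV[R]_a => v *m A) v.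
Proof.
by apply: (@linear_differentiable _ _ _ (mulmxr A)); exact: continuous_mulmxr.
Qed.

(** Chain rule for a linear substitution; it recovers Phi_u, Phi_y and their
    gradients from the joint cost on R^(m + p). *)
Section PrecompositionLinear.
Variables (a b : nat) (A : 'M[R]_(a, b)) (H : 'rV[R]_b -> R) (h : 'rV[R]_a -> R)
  (c : R).
Hypothesis dH : forall z, differentiable H z.
Hypothesis hE : forall v, h v = H (v *m A) - c.

Let hE' : h = (H \o (fun v => v *m A)) \- cst c.
Proof. by apply/funext => v; rewrite hE. Qed.

Lemma differentiable_comp_mulmxr v : differentiable h v.
Proof.
rewrite hE'; apply: differentiableB => //; apply: differentiable_comp => //.
exact: differentiable_mulmxr.
Qed.

Lemma grad_comp_mulmxr v : grad h v = grad H (v *m A) *m A^T.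
Proof.
have dA : differentiable (fun v : 'rV[R]_a => v *m A) v.
  exact: differentiable_mulmxr.
have dHA : differentiable (H \o (fun v => v *m A)) v by exact: differentiable_comp.
apply/rowP => i; rewrite [LHS]mxE hE' deriveB; last 2 first.
- exact: diff_derivable.
- exact: derivable_cst.
rewrite derive_cst subr0 deriveE// diff_comp//=.
have -> : 'd (fun v : 'rV[R]_a => v *m A) v (delta_mx ord0 i) = row i A.
  have cA : continuous (mulmxr A : 'rV[R]_a -> 'rV[R]_b) by exact: continuous_mulmxr.
  by rewrite (diff_lin v cA)/= -rowE.
rewrite -deriveE// derive_dotv_grad// mxE.
by apply: eq_bigr => k _; rewrite !mxE.
Qed.

Lemma lipschitz_grad_comp_mulmxr (K : set 'rV[R]_a) : compact K ->
  [locally [lipschitz grad H z | z in setT]] ->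
  exists2 L, 0 <= L &
    forall u v, K u -> K v -> `|grad h u - grad h v| <= L * `|u - v|.
Proof.
move=> cK H_lip.
have cKA : compact [set v *m A | v in K].
  by apply: continuous_compact => //; apply: continuous_subspaceT; exact: continuous_mulmxr.
have [L L0 LP] := locally_lipschitz_compact H_lip cKA.
exists (b%:R * `|A^T| * (L * (a%:R * `|A|))); first by rewrite !mulr_ge0.
move=> u v Ku Kv; rewrite !grad_comp_mulmxr -mulmxBl.
rewrite (le_trans (mulmx_norm_le _ _))// -!mulrA ler_wpM2l// mulrC ler_wpM2l//.
have [uA vA] : [set v *m A | v in K] (u *m A) /\ [set v *m A | v in K] (v *m A).
  by split; [exists u|exists v].
rewrite (le_trans (LP _ _ uA vA))// ler_wpM2l// -mulmxBl.
by rewrite (le_trans (mulmx_norm_le _ _))// [`|A| * _]mulrC.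
Qed.

End PrecompositionLinear.

Section PairingWithConstant.
Variables (a b : nat) (k : 'rV[R]_a -> 'rV[R]_b) (c : 'rV[R]_b).

Let pairE : (fun v => dotv (k v) c) =
  \sum_(i < b) (c ord0 i \*: (fun v => k v ord0 i)).
Proof.
by apply/funext => v; rewrite fct_sumE; apply: eq_bigr => i _; rewrite mulrC.
Qed.

Lemma differentiable_dotv v : differentiable k v ->
  differentiable (fun v => dotv (k v) c) v.
Proof.
move=> dk; rewrite pairE; apply: differentiable_sum => i.
apply: differentiableZ.
apply: (@differentiable_comp _ _ _ _ k (fun y => y ord0 i)) => //.
exact: differentiable_coord.
Qed.

Lemma grad_dotv v : differentiable k v ->
  grad (fun v => dotv (k v) c) v = c *m jac k v.
Proof.
move=> dk; apply/rowP => i; rewrite !mxE.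
set e := delta_mx _ _.
have dke : derivable k v e by exact: diff_derivable.
have dcoord j : is_derive v e (fun u => k u ord0 j) ('D_e k v ord0 j).
  apply: DeriveDef; first by move/derivable_mxP : dke; apply.
  by rewrite derive_mx// mxE.
rewrite pairE.
have [_ ->] := is_derive_sum (fun j => is_deriveZ (c ord0 j) (dcoord j)).
apply: eq_bigr => j _; rewrite deriveEjacobian// /e -rowE.
by rewrite [row _ _ _ _]mxE [jac _ _ _ _]mxE.
Qed.

End PairingWithConstant.

End Regularity.

Section Objective.
Context {R : realType} {m p : nat}.

Lemma grad_add (h k : 'rV[R]_m -> R) v : differentiable h v ->
  differentiable k v -> grad (fun u => h u + k u) v = grad h v + grad k v.
Proof.
move=> dh dk; apply/rowP => i; rewrite !mxE.
by rewrite -deriveD//; exact: diff_derivable.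
Qed.

Lemma strictly_convex_add_affine (h : 'rV[R]_m -> R) (k : 'rV[R]_m -> 'rV[R]_p)
    (c : 'rV[R]_p) :
  strictly_convex h -> affine k -> strictly_convex (fun v => h v + dotv (k v) c).
Proof.
move=> ch [A [b kE]] x y t xy t0 t1; have := ch x y t xy t0 t1.
have -> : k (t *: x + (1 - t) *: y) = t *: k x + (1 - t) *: k y.
  rewrite !kE mulmxDl -!scalemxAl !scalerDr addrACA -[t *: b + _]scalerDl.
  by rewrite subrKC scale1r.
by rewrite dotvDl !dotvZl; lra.
Qed.

End Objective.

Unset Implicit Arguments.

Theorem lemma3 (R : realType) (n m p : nat)
    (f : 'rV[R]_n -> 'rV[R]_m -> 'rV[R]_n) (g : 'rV[R]_n -> 'rV[R]_p)
    (kx : 'rV[R]_m -> 'rV[R]_n)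
    (Phi : 'rV[R]_m -> 'rV[R]_p -> R)
    (Phi_u : 'rV[R]_m -> R) (Phi_y : 'rV[R]_p -> R)
    (umin umax : 'rV[R]_m) (alpha : R)
    (ky := g \o kx) (U := box umin umax)
    (hplant : plant_assumption f g kx)
    (hcost : cost_assumption Phi Phi_u Phi_y umin umax)
    (hmono : monotone_system f g
               (nonneg_orthant m) (nonneg_orthant n) (nonneg_orthant p))
    (halpha : 0 < alpha)
    (hconvex :
       (forall x : 'rV[R]_n,
          strictly_convex (fun v => Phi_u v + dotv (ky v) (grad Phi_y (g x)))) \/
       (strictly_convex Phi_u /\ affine ky)) :
  exists kv : 'rV[R]_n -> 'rV[R]_m,
    steady_state_map
      (fun (v : 'rV[R]_m) (x : 'rV[R]_n) =>
         proj_tangent U v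
           (- (alpha *: grad Phi_u v)
            - alpha *: (grad Phi_y (g x) *m jac ky v)))
      U kv /\
    continuous kv.
Proof.
pose Phi' (z : 'rV[R]_(m + p)) := Phi (lsubmx z) (rsubmx z).
have dPhi' z : differentiable Phi' z by exact: (cost_diff hcost).
have Phi_uE v : Phi_u v = Phi' (v *m row_mx 1%:M 0) - Phi_y 0.
  rewrite /Phi' mul_mx_row mulmx1 mulmx0 row_mxKl row_mxKr.
  by rewrite (cost_split hcost) addrK.
have Phi_yE y : Phi_y y = Phi' (y *m row_mx 0 1%:M) - Phi_u 0.
  rewrite /Phi' mul_mx_row mulmx1 mulmx0 row_mxKl row_mxKr.
  by rewrite (cost_split hcost) addrAC subrr add0r.
have dPhi_u v : differentiable Phi_u v.
  exact: (differentiable_comp_mulmxr dPhi' Phi_uE).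
have dky v : differentiable ky v by exact: (plant_ky_diff hplant).
pose Q x := grad Phi_y (g x).
have cQ : continuous Q.
  move=> x; rewrite /Q.
  have -> : (fun x => grad Phi_y (g x)) =
      (fun z => z *m (row_mx 0 1%:M)^T) \o
      (grad Phi' \o ((fun y => y *m row_mx 0 1%:M) \o g)).
    by apply/funext => x'; rewrite (grad_comp_mulmxr dPhi' Phi_yE).
  apply: continuous_comp; last exact: continuous_mulmxr.
  apply: continuous_comp; last exact: (cost_C1 hcost).
  apply: continuous_comp; last exact: continuous_mulmxr.
  exact: (locally_lipschitz_continuous (plant_g_lip hplant)).
pose psi x v := Phi_u v + dotv (ky v) (Q x).
have psi_convex x : strictly_convex (psi x).
  by case: hconvex => [|[cPhi_u aff]]; [exact|exact: strictly_convex_add_affine].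
have dpsi x v : differentiable (psi x) v.
  by apply: differentiableD; [exact: dPhi_u|exact: differentiable_dotv].
have grad_psi x v : grad (psi x) v = grad Phi_u v + Q x *m jac ky v.
  by rewrite grad_add ?grad_dotv//; exact: differentiable_dotv.
have lohi := cost_box hcost.
have cU : compact U by exact: box_compact.
have [Lu Lu0 LuP] :=
  lipschitz_grad_comp_mulmxr dPhi' Phi_uE cU (cost_grad_lip hcost).
have [Lk Lk0 LkP] := locally_lipschitz_compact (plant_jac_ky_lip hplant) cU.
(* A Lipschitz constant on U of the free velocity at the input x. *)
pose L x := alpha * (Lu + p%:R * `|Q x| * Lk).
have L0 x : 0 <= L x by rewrite mulr_ge0 ?(ltW halpha)// addr_ge0// !mulr_ge0.
have velE x v : - (alpha *: grad Phi_u v) - alpha *: (Q x *m jac ky v) =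
    - (alpha *: grad (psi x) v).
  by rewrite grad_psi scalerDr opprD.
have vel_lip x u v : U u -> U v ->
    `|- (alpha *: grad (psi x) u) - - (alpha *: grad (psi x) v)| <=
      L x * `|u - v|.
  move=> Uu Uv; rewrite -opprD normrN -scalerBr normrZ gtr0_norm// -mulrA.
  rewrite ler_pM2l// !grad_psi opprD addrACA -mulmxBr mulrDl.
  rewrite (le_trans (ler_normD _ _))// lerD//; first exact: LuP.
  rewrite (le_trans (mulmx_norm_le _ _))// mulrA -[leRHS]mulrA ler_wpM2l//.
  exact: LkP.
have [K KP] := box_bounded umin umax.
have Umin : U umin by exact: box_lo.
have /choice[kv kvP] x : exists vs, U vs /\
    forall v, U v -> v <> vs -> psi x vs < psi x v.
  have [|vs Uvs vsmin] := box_argmin lohi _ (psi_convex x).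
    by move=> v; exact: differentiable_continuous.
  by exists vs.
exists kv; split; last first.
  apply: (argmin_continuous (A := Phi_u) (B := ky) lohi _ _ cQ).
  - by move=> v; exact: differentiable_continuous.
  - by move=> v; exact: differentiable_continuous.
  - by move=> x; have [] := kvP x.
  - by move=> x v Uv vk; have [_] := kvP x; apply.
move=> x z0 Uz0; have [Ukv kvmin] := kvP x.
pose M := `|- (alpha *: grad (psi x) umin)| + L x * K.
have K0 : 0 <= K by rewrite (le_trans _ (KP _ _ Umin Umin)).
have velM u : U u -> `|- (alpha *: grad (psi x) u)| <= M.
  move=> Uu; rewrite -lerBlDl (le_trans (lerB_dist _ _))//.
  rewrite (le_trans (vel_lip x _ _ Uu Umin))// ler_wpM2l//.
  exact: KP.
have := box_gradient_flow lohi halpha (dpsi x) (psi_convex x) (L0 x) _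
  (vel_lip x) velM Ukv kvmin Uz0.
rewrite /=; under eq_fun do under eq_fun do rewrite -velE.
apply; by rewrite addr_ge0// mulr_ge0.
Qed.
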